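(* Let $G$ be an lcsc group with Haar measure $m_G$ and let $d$ be a left-invariant metric on $G$ whose closed balls $B_t=\{g: d(e,g)\le t\}$ are compact of positive measure for $t>0$. Assume that the balls satisfy the doubling condition $m_G(B_{2t})\le C\,m_G(B_t)$ for all $t>0$, and that they are asymptotically invariant under right translations, i.e. $\lim_{t\to\infty}m_G(B_tg\,\Delta\,B_t)/m_G(B_t)=0$ for every $g\in G$. Then the ball averages $\beta_t$ (probability measures with density $\chi_{B_t}/m_G(B_t)$) satisfy the pointwise ergodic theorem in $L^p$ for every $1\le p<\infty$.
   Context: For a measure-preserving action of $G$ on a probability space $(X,m)$ and a probability measure $\mu$ on $G$, $\pi(\mu)f(x)=\int_G f(g^{-1}x)\,d\mu(g)$. A family $\mu_t$ ($t\to\infty$) of probability measures on $G$ satisfies the pointwise ergodic theorem in $L^p$ if for every ergodic measure-preserving action of $G$ on a standard probability space $(X,m)$ and every $f\in L^p(X)$, $\lim_{t\to\infty}\pi(\mu_t)f(x)=\int_X f\,dm$ for $m$-almost every $x$ and in the $L^p(X)$-norm. *)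

(* Defs.v *)
From HB Require Import structures.
From mathcomp Require Import all_boot all_order all_algebra.
From mathcomp Require Import all_classical all_reals all_analysis.
Set Implicit Arguments. Unset Strict Implicit. Unset Printing Implicit Defensive.
Import Order.TTheory GRing.Theory Num.Def Num.Theory.
Local Open Scope classical_set_scope.
Local Open Scope ring_scope.

Definition Borel (G : ptopologicalType) := g_sigma_algebraType (@open G).

Definition lcsc_group (G : ptopologicalType) (mul : G -> G -> G)
    (inv : G -> G) (one : G) : Prop :=
  [/\ (forall x y z, mul x (mul y z) = mul (mul x y) z),
      (forall x, mul one x = x /\ mul x one = x),
      (forall x, mul (inv x) x = one /\ mul x (inv x) = one),
      continuous (fun q : G * G => mul q.1 q.2) /\ continuous inv &
      [/\ hausdorff_space G, locally_compact [set: G] & @second_countable G]].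

(** left Haar measure: nonzero-on-opens, finite-on-compacts,
    left-invariant Borel measure (automatically regular on an lcsc group). *)
Definition left_haar_measure (R : realType) (G : ptopologicalType)
    (mul : G -> G -> G) (mG : {measure set (Borel G) -> \bar R}) : Prop :=
  [/\ (forall (g : G) (A : set (Borel G)), measurable A ->
         mG [set mul g a | a in A] = mG A),
      (forall K : set G, compact K -> (mG K < +oo)%E) &
      (forall U : set G, open U -> U !=set0 -> (0 < mG U)%E)].

Definition left_invariant_metric (R : realType) (G : Type)
    (mul : G -> G -> G) (d : G -> G -> R) : Prop :=
  [/\ (forall x y, d x y = 0 <-> x = y),
      (forall x y, d x y = d y x),
      (forall x y z, d x z <= d x y + d y z) &
      (forall g x y, d (mul g x) (mul g y) = d x y)].

Definition cball (R : realType) (G : Type) (d : G -> G -> R) (one : G) (t : R)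
  : set G := [set g | d one g <= t].

Definition rtrans (G : Type) (mul : G -> G -> G) (A : set G) (g : G) : set G :=
  [set mul a g | a in A].

Definition symdiff (T : Type) (A B : set T) : set T := (A `\` B) `|` (B `\` A).

Definition mp_action (R : realType) (G : ptopologicalType)
    (mul : G -> G -> G) (one : G)
    {dX} (X : measurableType dX) (mX : {measure set X -> \bar R})
    (act : G -> X -> X) : Prop :=
  [/\ (forall x, act one x = x),
      (forall g h x, act (mul g h) x = act g (act h x)),
      measurable_fun [set: Borel G * X] (fun q : Borel G * X => act q.1 q.2) &
      (forall (g : G) (A : set X), measurable A -> mX (act g @^-1` A) = mX A)].

Definition ergodic_action (R : realType) (G : Type)
    {dX} (X : measurableType dX) (mX : {measure set X -> \bar R})
    (act : G -> X -> X) : Prop :=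
  forall A : set X, measurable A -> (forall g, act g @^-1` A = A) ->
    mX A = 0%E \/ mX A = 1%E.

(** standard Borel space: Borel-isomorphic to a Borel subset of R
    (an injective measurable map into R mapping measurable sets to
    measurable sets). *)
Definition standard_borel (R : realType) {dX} (X : measurableType dX) : Prop :=
  exists phi : X -> R, [/\ injective phi, measurable_fun [set: X] phi &
    forall A : set X, measurable A -> measurable (phi @` A)].

Definition ball_average (R : realType) (G : ptopologicalType)
    (inv : G -> G) (one : G) (d : G -> G -> R)
    (mG : {measure set (Borel G) -> \bar R})
    {dX} (X : measurableType dX) (act : G -> X -> X) (f : X -> R)
    (t : R) (x : X) : R :=
  fine (\int[mG]_(g in (cball d one t : set (Borel G))) (f (act (inv g) x))%:E)
    / fine (mG (cball d one t)).

(* Main.v *)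
(** Write A_t f for the ball averages of f along orbits.

    Maximal inequality.  By left invariance of d, averaging f along B_t at
    g^-1 x amounts to averaging u |-> f (u^-1 x) over the metric ball of centre
    g and radius t.  The Vitali covering argument for the doubling measure m_G
    gives a weak (1,1) inequality on G; integrating it over X along the ball of
    radius 2^K and using the invariance of the measure on X transfers it to X.

    Dense class.  If h is bounded then A_t (h - A_s h) -> 0 uniformly: by left
    invariance and the symmetry of d the difference A_t h - A_t A_s h is
    controlled by the mass of the pairs (g, u) with g in B_t, u outside B_t and
    d g u <= s, which is the integral over v in B_s of
    m_G {g in B_t | g v not in B_t}, hence o(m_G B_t) by asymptotic invariance.
    No unimodularity is needed.

    Density.  Let q range over the bounded functions with A_t q -> 0 uniformly,
    and let r_n = f - q_n minimise the L2 norm asymptotically.  By the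
    parallelogram law (r_n) is Cauchy, and comparing r_n with
    r_n - (r_n - A_s r_n) / 2 shows that the integral of
    |r_n (g^-1 x) - r_n x|^2 over g in B_s and x in X tends to 0.  So the limit
    is invariant, hence constant by ergodicity, and the f - q_n converge to the
    mean of f.

    The maximal inequality and Borel-Cantelli extend the convergence almost
    everywhere from this class to L1; Jensen's inequality makes A_t a
    contraction of Lp, which gives convergence in norm. *)

Require Import Defs.
From HB Require Import structures.
From mathcomp Require Import all_boot all_order all_algebra.
From mathcomp Require Import all_classical all_reals all_analysis.
From mathcomp Require Import measurable_realfun ring lra.
Set Implicit Arguments. Unset Strict Implicit. Unset Printing Implicit Defensive.
Import Order.TTheory GRing.Theory Num.Def Num.Theory.
Import numFieldNormedType.Exports.
Local Open Scope classical_set_scope.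
Local Open Scope ring_scope.

(* The set [set g | cball d one t (mul g u)] in ball_folner is the right
   translate of the ball by the inverse of u. *)
Record doubling_group (R : realType) dG (G : measurableType dG)
    (mul : G -> G -> G) (inv : G -> G) (one : G)
    (m : {sigma_finite_measure set G -> \bar R}) (d : G -> G -> R) (C : R)
    : Prop := DoublingGroup {
  gmulA : forall x y z, mul x (mul y z) = mul (mul x y) z;
  gmul1 : forall x, mul one x = x;
  gmulg1 : forall x, mul x one = x;
  gmulV : forall x, mul (inv x) x = one;
  gmulgV : forall x, mul x (inv x) = one;
  distC : forall x y, d x y = d y x;
  dist_tri : forall x y z, d x z <= d x y + d y z;
  dist_mul : forall g x y, d (mul g x) (mul g y) = d x y;
  gmul_meas : measurable_fun setT (fun q : G * G => mul q.1 q.2);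
  ginv_meas : measurable_fun setT inv;
  haar_mul : forall g A, measurable A -> m (mul g @^-1` A) = m A;
  ball_meas : forall t, measurable (cball d one t);
  ball_gt0 : forall t, 0 < t -> (0 < m (cball d one t))%E;
  ball_lty : forall t, (m (cball d one t) < +oo)%E;
  ball_double : forall t, 0 < t ->
    (m (cball d one (2 * t)) <= C%:E * m (cball d one t))%E;
  ball_folner : forall u : G,
    fine (m (cball d one t `\` [set g | cball d one t (mul g u)]))
      / fine (m (cball d one t)) @[t --> +oo] --> 0 }.

Record pmp_action (R : realType) dG (G : measurableType dG) dX
    (X : measurableType dX) (mul : G -> G -> G)
    (mu : probability X R) (act : G -> X -> X) : Prop := PmpAction {
  actM : forall g h x, act (mul g h) x = act g (act h x);
  act_meas : measurable_fun setT (fun q : G * X => act q.1 q.2);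
  act_mp : forall g A, measurable A -> mu (act g @^-1` A) = mu A }.

(** Tonelli integrates over whole spaces, so a ball as domain of integration has to become a factor
    of the integrand. *)
Lemma integral_indic_mull d (T : measurableType d) (R : realType)
    (mu : {measure set T -> \bar R}) (D : set T) (f : T -> \bar R) :
  (\int[mu]_(x in D) f x = \int[mu]_x ((\1_D x)%:E * f x))%E.
Proof.
rewrite integral_mkcond epatch_indic; apply: eq_integral => x _.
by rewrite muleC.
Qed.

(** The pushforward of [mu] under [phi] agrees with [mu] on measurable sets. Serves both for left
    translations of the group and for the action. *)
Lemma ge0_integral_preserving d (T : measurableType d) (R : realType)
    (mu : {measure set T -> \bar R}) (phi : T -> T) (F : T -> \bar R) :
  measurable_fun setT phi ->
  (forall A, measurable A -> mu (phi @^-1` A) = mu A) ->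
  measurable_fun setT F -> (forall x, 0 <= F x)%E ->
  (\int[mu]_x F (phi x) = \int[mu]_x F x)%E.
Proof.
move=> mphi pres mF F0.
rewrite -[LHS](ge0_integral_pushforward mphi mu measurableT mF) => [|//].
apply: eq_measure_integral => A mA _ /=; exact: pres.
Qed.

Definition bounded_meas (R : realType) d (T : measurableType d) (f : T -> R) :=
  measurable_fun setT f /\ exists M : R, forall x, `|f x| <= M.

(** * Ball averages along orbits: measurability, invariance of the mean, linearity, bounds *)

Section Basics.
Context {R : realType} {dG dX : measure_display}.
Context {G : measurableType dG} {X : measurableType dX}.
Variables (mul : G -> G -> G) (inv : G -> G) (one : G).
Variable m : {sigma_finite_measure set G -> \bar R}.
Variables (d : G -> G -> R) (C : R).
Variables (mu : probability X R) (act : G -> X -> X).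
Hypothesis HG : doubling_group mul inv one m d C.
Hypothesis HA : pmp_action mul mu act.

Local Notation B := (cball d one).
Implicit Types (t c M a b : R) (f : X -> R).

Definition ball_vol t : R := fine (m (B t)).
Local Notation bvol := ball_vol.

Lemma bvolE t : m (B t) = (bvol t)%:E.
Proof. by rewrite /ball_vol fineK// ge0_fin_numE ?measure_ge0// (ball_lty HG). Qed.

Lemma integral_ball_cst c t : (\int[m]_(g in B t) c%:E = (c * bvol t)%:E)%E.
Proof.
rewrite integral_cst ?EFinM; last exact: (ball_meas HG).
by congr (_ * _)%E; exact: bvolE.
Qed.

Lemma bvol_gt0 t : 0 < t -> 0 < bvol t.
Proof. by move=> t0; rewrite -lte_fin -bvolE (ball_gt0 HG). Qed.

Lemma gmulKV g u : mul (inv g) (mul g u) = u.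
Proof. by rewrite (gmulA HG) (gmulV HG) (gmul1 HG). Qed.

Lemma gmulVK g u : mul g (mul (inv g) u) = u.
Proof. by rewrite (gmulA HG) (gmulgV HG) (gmul1 HG). Qed.

Lemma ginvM g h : inv (mul g h) = mul (inv h) (inv g).
Proof.
rewrite -[RHS](gmulg1 HG) -(gmulgV HG (mul g h)) (gmulA HG).
by rewrite -(gmulA HG (inv h)) gmulKV (gmulV HG) (gmul1 HG).
Qed.

Lemma gmulr_meas g : measurable_fun setT (mul g).
Proof.
exact: (measurableT_comp (gmul_meas HG) (pair1_measurable g)).
Qed.

Lemma act_pmeas g : measurable_fun setT (act g).
Proof. exact: (measurableT_comp (act_meas HA) (pair1_measurable g)). Qed.

Lemma orbit_meas2 d' (Z : measurableType d') (F : X -> Z) :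
  measurable_fun setT F ->
  measurable_fun setT (fun q : G * X => F (act (inv q.1) q.2)).
Proof.
move=> mF; apply: (measurableT_comp mF).
have h : measurable_fun [set: G * X] (fun q : G * X => (inv q.1, q.2)).
  apply: measurable_fun_pair => //.
  exact: measurableT_comp (ginv_meas HG) _.
exact: (measurableT_comp (act_meas HA) h).
Qed.

Lemma orbit_meas d' (Z : measurableType d') (F : X -> Z) x :
  measurable_fun setT F -> measurable_fun setT (fun g => F (act (inv g) x)).
Proof.
by move=> /orbit_meas2 h; exact: (measurableT_comp h (pair2_measurable x)).
Qed.

(** The average before normalisation, kept extended-real valued so that Tonelli and monotonicity
    apply to nonnegative functions with no integrability condition. *)
Definition orbit_int (F : X -> \bar R) t x : \bar R :=
  (\int[m]_(g in B t) F (act (inv g) x))%E.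
Local Notation orbint := orbit_int.

Lemma orbint_ge0 F t x : (forall y, 0 <= F y)%E -> (0 <= orbint F t x)%E.
Proof. by move=> F0; apply: integral_ge0. Qed.

Lemma ball_indic_mul_meas (F : X -> \bar R) t : measurable_fun setT F ->
  measurable_fun setT
    (fun q : G * X => (\1_(B t) q.1)%:E * F (act (inv q.1) q.2))%E.
Proof.
move=> mF; apply: emeasurable_funM; last exact: orbit_meas2.
apply/measurable_EFinP; apply: measurableT_comp => //.
by apply/measurable_indicP; exact: (ball_meas HG).
Qed.

Lemma orbint_meas F t : measurable_fun setT F -> (forall y, 0 <= F y)%E ->
  measurable_fun setT (orbint F t).
Proof.
move=> mF F0.
rewrite (_ : orbint F t =
    fubini_G m (fun q : G * X => (\1_(B t) q.1)%:E * F (act (inv q.1) q.2))%E).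
  apply: measurable_fun_fubini_tonelli_G; first exact: ball_indic_mul_meas.
  by move=> q; rewrite mule_ge0// lee_fin.
by apply/funext => x; rewrite /orbit_int integral_indic_mull.
Qed.

(** After Tonelli the inner integral runs over X at fixed g, where invariance of [mu] removes
    [act (inv g)]; the outer integral then returns the volume of the ball. *)
Lemma integral_orbint F t : measurable_fun setT F -> (forall y, 0 <= F y)%E ->
  (\int[mu]_x orbint F t x = (bvol t)%:E * \int[mu]_x F x)%E.
Proof.
move=> mF F0.
under eq_integral do rewrite /orbit_int integral_indic_mull.
rewrite -(fubini_tonelli (m1 := m) (m2 := mu)
  (fun q : G * X => (\1_(B t) q.1)%:E * F (act (inv q.1) q.2))%E); last 2 first.
- exact: ball_indic_mul_meas.
- by move=> q; rewrite mule_ge0// lee_fin.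
have -> : (bvol t)%:E = (\int[m]_g (\1_(B t) g)%:E)%E.
  rewrite -[bvol t]mul1r -integral_ball_cst integral_indic_mull.
  by apply: eq_integral => g _; rewrite mule1.
rewrite -ge0_integralZr//; last 2 first.
- by apply/measurable_EFinP/measurable_indicP; exact: (ball_meas HG).
- exact: integral_ge0.
apply: eq_integral => g _ /=.
rewrite ge0_integralZl//; last exact: (measurableT_comp mF (act_pmeas _)).
congr (_ * _)%E; apply: ge0_integral_preserving => //; first exact: act_pmeas.
exact: (act_mp HA).
Qed.

(** Convertible to [ball_average]. Where the orbit integral is infinite [fine] makes the average 0;
    [avg_dist] covers that case. *)
Definition orbit_avg (f : X -> R) t x : R :=
  fine (\int[m]_(g in B t) (f (act (inv g) x))%:E) / bvol t.
Local Notation avg := orbit_avg.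

Lemma bounded_orbit_integrable f t x : bounded_meas f ->
  m.-integrable (B t) (fun g => (f (act (inv g) x))%:E).
Proof.
move=> [mf [M hM]]; apply: (measurable_bounded_integrable (f := fun g => f (act (inv g) x))).
- exact: (ball_meas HG).
- exact: (ball_lty HG).
- exact: measurable_funTS (orbit_meas x mf).
- exists M; split; first by rewrite num_real.
  by move=> y My g _ /=; rewrite (le_trans (hM _))// ltW.
Qed.

Lemma bounded_meas_cst c : bounded_meas (cst c : X -> R).
Proof. by split => //; exists `|c|. Qed.

Lemma avgE f t x : 0 < t -> bounded_meas f ->
  ((bvol t * avg f t x)%:E = \int[m]_(g in B t) (f (act (inv g) x))%:E)%E.
Proof.
move=> t0 bf; rewrite /orbit_avg mulrCA divff ?gt_eqF ?bvol_gt0// mulr1 fineK//.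
apply: integrable_fin_num; first exact: (ball_meas HG).
exact: bounded_orbit_integrable.
Qed.

Lemma avg_cst c t x : 0 < t -> avg (cst c) t x = c.
Proof.
move=> t0; rewrite /orbit_avg integral_ball_cst /=.
by rewrite mulfK// gt_eqF// bvol_gt0.
Qed.

Lemma avg_lin a b f (g : X -> R) t x : bounded_meas f -> bounded_meas g ->
  avg (fun y => a * f y + b * g y) t x = a * avg f t x + b * avg g t x.
Proof.
move=> bf bg; rewrite /orbit_avg.
have If := bounded_orbit_integrable t x bf.
have Ig := bounded_orbit_integrable t x bg.
have mB := ball_meas HG t.
under eq_integral do rewrite EFinD !EFinM.
rewrite integralD//; [|exact: integrableZl|exact: integrableZl].
rewrite !integralZl// fineD ?fin_numM ?(integrable_fin_num _ If)
  ?(integrable_fin_num _ Ig)//.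
rewrite !fineM ?(integrable_fin_num _ If) ?(integrable_fin_num _ Ig)//=.
by rewrite mulrDl !mulrA.
Qed.

Lemma avg_meas f t : measurable_fun setT f -> measurable_fun setT (avg f t).
Proof.
move=> mf; apply: measurable_funM => //.
apply: measurableT_comp => //.
(* [orbint_meas] covers nonnegative functions only, hence the positive and negative parts. *)
rewrite (_ : (fun _ => _) = (fun x =>
    orbint (fun y => (EFin \o f)^\+ y) t x
    - orbint (fun y => (EFin \o f)^\- y) t x)%E).
  apply: emeasurable_funB; apply: orbint_meas => //.
    by apply: measurable_funepos; exact/measurable_EFinP.
  by apply: measurable_funeneg; exact/measurable_EFinP.
apply/funext => x; rewrite [LHS]integralE.
rewrite /orbit_int; congr (_ - _)%E; apply: eq_integral => h _.
  by rewrite !funeposE.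
by rewrite !funenegE.
Qed.

Lemma avg_le f t x M : 0 < t -> bounded_meas f -> (forall y, f y <= M) ->
  avg f t x <= M.
Proof.
move=> t0 bf fM; rewrite -(ler_pM2l (bvol_gt0 t0)) -lee_fin avgE//.
have -> : ((bvol t * M)%:E = \int[m]_(g in B t) cst M%:E g)%E.
  by rewrite integral_ball_cst mulrC.
apply: le_integral; first exact: (ball_meas HG).
- exact: bounded_orbit_integrable.
- exact: (bounded_orbit_integrable t x (bounded_meas_cst M)).
- by move=> g _; rewrite lee_fin.
Qed.

Lemma bounded_meas_lin a b (f g : X -> R) : bounded_meas f -> bounded_meas g ->
  bounded_meas (fun y => a * f y + b * g y).
Proof.
move=> [mf [M fM]] [mg [N gN]]; split.
  by apply: measurable_funD; apply: measurable_funM.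
exists (`|a| * M + `|b| * N) => x; rewrite (le_trans (ler_normD _ _))//.
by rewrite !normrM lerD// ler_wpM2l.
Qed.

Lemma bounded_measM (f g : X -> R) : bounded_meas f -> bounded_meas g ->
  bounded_meas (fun y => f y * g y).
Proof.
move=> [mf [M fM]] [mg [N gN]]; split; first exact: measurable_funM.
by exists (M * N) => x; rewrite normrM ler_pM.
Qed.

Lemma avg_bound f t x M : 0 < t -> bounded_meas f -> (forall y, `|f y| <= M) ->
  `|avg f t x| <= M.
Proof.
move=> t0 bf fM; rewrite ler_norml; apply/andP; split; last first.
  by apply: avg_le => // y; rewrite (le_trans (ler_norm _)).
(* The lower bound is [avg_le] for - f, written as the combination -1 * f + 0 * f. *)
rewrite lerNl; have := @avg_lin (-1) 0 f f t x bf bf.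
rewrite mul0r addr0 mulN1r => <-; apply: avg_le => //.
  exact: bounded_meas_lin.
by move=> y; rewrite mul0r addr0 mulN1r (le_trans (ler_norm _))// normrN.
Qed.

Lemma avg_bounded f t : 0 < t -> bounded_meas f -> bounded_meas (avg f t).
Proof.
move=> t0 bf; split; first exact: avg_meas bf.1.
by case: (bf) => _ [M fM]; exists M => x; exact: avg_bound.
Qed.

(* When the right-hand side is finite, f is integrable along the orbit because
   f - g and g are; otherwise there is nothing to prove. *)
Lemma avg_dist f (g : X -> R) t x : 0 < t -> measurable_fun setT f -> bounded_meas g ->
  ((bvol t * `|avg f t x - avg g t x|)%:E
   <= orbint (fun y => (`|f y - g y|)%:E) t x)%E.
Proof.
move=> t0 mf bg; have mB := ball_meas HG t.
have [->|ltoo] := eqVneq (orbint (fun y => (`|f y - g y|)%:E) t x) +oo%E.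
  by rewrite leey.
have Ig := bounded_orbit_integrable t x bg.
have mfg : measurable_fun setT (fun y => f y - g y).
  by apply: measurable_funB => //; case: bg.
have Ifg : m.-integrable (B t) (EFin \o (fun h => f (act (inv h) x) - g (act (inv h) x))).
  apply/integrableP; split.
    apply/measurable_EFinP; apply: measurable_funTS.
    exact: (orbit_meas x mfg).
  rewrite ltey; apply: contra ltoo => /eqP <-; apply/eqP.
  by apply: eq_integral => h _ /=.
have If : m.-integrable (B t) (fun h => (f (act (inv h) x))%:E).
  have := integrableD mB Ifg Ig; apply: eq_integrable => // h _ /=.
  by rewrite -EFinD subrK.
rewrite /orbit_avg -mulrBl normrM [`|_^-1|]gtr0_norm ?invr_gt0 ?bvol_gt0//.
rewrite mulrCA divff ?gt_eqF ?bvol_gt0// mulr1.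
rewrite -fineB ?(integrable_fin_num _ If) ?(integrable_fin_num _ Ig)//.
rewrite -integralB//.
rewrite -fine_abse; last first.
  by rewrite (integrable_fin_num _ (integrableB mB If Ig)).
rewrite fineK ?abse_fin_num ?(integrable_fin_num _ (integrableB mB If Ig))//.
apply: le_trans (le_abse_integral _ _ _) _ => //.
  by case/integrableP : (integrableB mB If Ig).
Qed.

Lemma orbintD F1 F2 t x : measurable_fun setT F1 -> (forall y, 0 <= F1 y)%E ->
  measurable_fun setT F2 -> (forall y, 0 <= F2 y)%E ->
  orbint (fun y => F1 y + F2 y)%E t x = (orbint F1 t x + orbint F2 t x)%E.
Proof.
move=> m1 p1 m2 p2; rewrite /orbit_int ge0_integralD//.
- exact: (ball_meas HG).
- exact: measurable_funTS (orbit_meas x m1).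
- exact: measurable_funTS (orbit_meas x m2).
Qed.

Lemma le_orbint F1 F2 t x : measurable_fun setT F1 -> (forall y, 0 <= F1 y)%E ->
  measurable_fun setT F2 -> (forall y, F1 y <= F2 y)%E ->
  (orbint F1 t x <= orbint F2 t x)%E.
Proof.
move=> m1 p1 m2 p2; apply: ge0_le_integral => //.
- exact: (ball_meas HG).
- exact: measurable_funTS (orbit_meas x m1).
- exact: measurable_funTS (orbit_meas x m2).
Qed.

End Basics.

(** * Maximal inequality: covering on the group, then transference to X *)

Section Maximal.
Context {R : realType} {dG dX : measure_display}.
Context {G : measurableType dG} {X : measurableType dX}.
Variables (mul : G -> G -> G) (inv : G -> G) (one : G).
Variable m : {sigma_finite_measure set G -> \bar R}.
Variables (d : G -> G -> R) (C : R).
Variables (mu : probability X R) (act : G -> X -> X).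
Hypothesis HG : doubling_group mul inv one m d C.
Hypothesis HA : pmp_action mul mu act.

Local Notation B := (cball d one).
Local Notation bvol := (ball_vol one m d).
Local Notation orbint := (orbit_int inv one m d act).
Implicit Types (t lam : R) (F : X -> \bar R).

Lemma cball_translate g t : cball d g t = mul (inv g) @^-1` B t.
Proof.
apply/funext => u; rewrite /cball /=; congr (is_true (_ <= _)).
by rewrite -(dist_mul HG g one) (gmulVK HG) (gmulg1 HG).
Qed.

Lemma cball_meas g t : measurable (cball d g t).
Proof.
rewrite cball_translate -[X in measurable X]setTI.
by apply: (gmulr_meas HG) => //; exact: (ball_meas HG).
Qed.

Lemma cball_vol g t : m (cball d g t) = (bvol t)%:E.
Proof.
rewrite cball_translate -(bvolE HG).
exact: (haar_mul HG (inv g) (ball_meas HG t)).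
Qed.

Lemma bvol_le s t : s <= t -> bvol s <= bvol t.
Proof.
move=> st; rewrite -lee_fin -!(bvolE HG) le_measure ?inE//; try exact: (ball_meas HG).
by move=> u /= /le_trans; apply.
Qed.

Lemma bvol_double t : 0 < t -> bvol (2 * t) <= C * bvol t.
Proof. by move=> t0; have := ball_double HG t0; rewrite !(bvolE HG). Qed.

Lemma doubling_ge1 : 1 <= C.
Proof.
rewrite -(ler_pM2r (bvol_gt0 HG ltr01)) mul1r.
apply: (le_trans _ (bvol_double ltr01)); apply: bvol_le; rewrite mulr1.
by rewrite ler1n.
Qed.

(* The induction is on the measure of W in units of bvol 1: remove from W a
   ball of maximal radius; a ball of the family meeting it has its centre in
   the concentric ball of twice the radius. *)
Lemma vitali_doubling (F : G -> \bar R) lam (K N : nat) (W : set G)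
    (Fam : set (G * nat)) :
  measurable_fun setT F -> (forall g, 0 <= F g)%E -> 0 < lam ->
  measurable W -> (m W <= (N%:R * bvol 1)%:E)%E ->
  (forall g k, Fam (g, k) -> [/\ (k <= K)%N, cball d g (2 ^+ k) `<=` W &
    ((lam * bvol (2 ^+ k))%:E <= \int[m]_(u in cball d g (2 ^+ k)) F u)%E]) ->
  exists V, [/\ measurable V, forall g k, Fam (g, k) -> V g &
    (lam%:E * m V <= C%:E * \int[m]_(u in W) F u)%E].
Proof.
move=> mF F0 lam0; elim: N W Fam => [|N IH] W Fam mW hW hFam.
  (* With N = 0 the set [W] is null, while a ball of the family inside it would have positive
     volume; so the family is empty. *)
  exists set0; split => //.
    move=> g k /hFam[_ gW _].
    have : ((bvol (2 ^+ k))%:E <= (0 : R)%:E)%E.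
      rewrite -(cball_vol g) -(mul0r (bvol 1)); apply: le_trans hW.
      by apply: le_measure => //; rewrite inE//; exact: cball_meas.
    by rewrite lee_fin leNgt (bvol_gt0 HG)// exprn_gt0.
  rewrite measure0 mule0 mule_ge0 ?integral_ge0// lee_fin.
  by rewrite (le_trans _ doubling_ge1).
have [noF|] := pselect (forall k, ~ `[< exists g, Fam (g, k) >]).
  exists set0; split => //.
    by move=> g k gk; case: (noF k); apply/asboolP; exists g.
  rewrite measure0 mule0 mule_ge0 ?integral_ge0// lee_fin.
  by rewrite (le_trans _ doubling_ge1).
move=> /existsNP[k0 /contrapT Fk0].
have exF : exists k, `[< exists g, Fam (g, k) >] by exists k0.
have bdF k : `[< exists g, Fam (g, k) >] -> (k <= K)%N.
  by move=> /asboolP[g /hFam[]].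
case: (ex_maxnP exF bdF) => k /asboolP[g Fgk] kmax {k0 Fk0 exF bdF}.
have [_ bW hb] := hFam _ _ Fgk.
set b := cball d g (2 ^+ k) in bW hb.
have mb : measurable b by exact: cball_meas.
have mW' : measurable (W `\` b) by exact: measurableD.
have WE : (W `\` b) `|` b = W by rewrite setUC setDUK.
have disj : [disjoint W `\` b & b].
  by apply/disj_setPS => u [[_ nb] bu].
have mWE : m W = (m (W `\` b) + (bvol (2 ^+ k))%:E)%E.
  rewrite -[in LHS]WE measureU//; last exact/disj_set2P.
  by congr (_ + _)%E; exact: cball_vol.
(* The removed ball has radius at least 1, so its volume is at least [bvol 1] and the bound loses
   one unit. *)
have hW' : (m (W `\` b) <= (N%:R * bvol 1)%:E)%E.
  rewrite -(@leeD2rE _ (bvol (2 ^+ k))%:E)// -mWE (le_trans hW)//.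
  rewrite -EFinD lee_fin -[N.+1]addn1 natrD mulrDl mul1r lerD2l bvol_le//.
  by rewrite exprn_ege1// ler1n.
pose Fam' : set (G * nat) :=
  [set p | Fam p /\ cball d p.1 (2 ^+ p.2) `&` b = set0].
have hFam' : forall h j, Fam' (h, j) -> [/\ (j <= K)%N,
    cball d h (2 ^+ j) `<=` W `\` b &
    ((lam * bvol (2 ^+ j))%:E <= \int[m]_(u in cball d h (2 ^+ j)) F u)%E].
  move=> h j [/hFam[jK jW hj] /= dis]; split => // u hu; split; first exact: jW.
  by move=> bu; rewrite -[False]/(set0 u) -dis.
have [V [mV VF hV]] := IH _ _ mW' hW' hFam'.
(* [V] is paid for by the integral of F over [W] minus [b]; the doubled ball, of volume at most C
   times that of [b], by the integral over [b]. *)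
exists (V `|` cball d g (2 * 2 ^+ k)); split.
- by apply: measurableU => //; exact: cball_meas.
- move=> h j hj.
  have [dis|/set0P[u [/= hu gu]]] := eqVneq (cball d h (2 ^+ j) `&` b) set0.
    by left; apply: (VF h j); split.
  right; rewrite /cball /=; rewrite (le_trans (dist_tri HG g u h))//.
  rewrite mulr2n mulrDl mul1r lerD// (distC HG) (le_trans hu)//.
  by rewrite ler_eXn2l ?ltr1n// kmax//; apply/asboolP; exists h.
- have mF' D : measurable D -> measurable_fun D F.
    by move=> mD; exact: measurable_funTS.
  rewrite -WE ge0_integral_setU//; last first.
    by rewrite WE; exact: mF'.
  rewrite ge0_muleDr ?integral_ge0//.
  apply: (@le_trans _ _ (lam%:E * (m V + (bvol (2 * 2 ^+ k))%:E))%E).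
    rewrite lee_pmul2l//.
    rewrite -(cball_vol g) measureU2//; exact: cball_meas.
  rewrite ge0_muleDr ?lee_fin//; last first.
    by rewrite ltW// (bvol_gt0 HG)// mulr_gt0 ?exprn_gt0.
  apply: leeD => //.
  apply: (@le_trans _ _ (C%:E * (lam * bvol (2 ^+ k))%:E)%E); last first.
    by rewrite lee_pmul2l// lte_fin (lt_le_trans _ doubling_ge1).
  by rewrite -!EFinM lee_fin mulrCA ler_pM2l// bvol_double// exprn_gt0.
Qed.

(** Substitute u = g h: the point h^-1 g^-1 x is (g h)^-1 x, and h lies in the ball at [one] exactly
    when g h lies in the ball at g. *)
Lemma orbint_translate F t g x : measurable_fun setT F -> (forall y, 0 <= F y)%E ->
  orbint F t (act (inv g) x) = (\int[m]_(u in cball d g t) F (act (inv u) x))%E.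
Proof.
move=> mF F0; rewrite /orbit_int integral_indic_mull [RHS]integral_indic_mull.
rewrite -[RHS](ge0_integral_preserving (gmulr_meas HG g) (haar_mul HG g)).
- apply: eq_integral => h _; congr (_%:E * F _)%E; last first.
    by rewrite (ginvM HG) (actM HA).
  rewrite !indicE; congr ((_ : bool)%:R); apply/idP/idP; rewrite !inE /cball /=;
  by rewrite -{1}(gmulg1 HG g) (dist_mul HG).
- apply: emeasurable_funM; last exact: (orbit_meas HG HA).
  by apply/measurable_EFinP/measurable_indicP; exact: cball_meas.
- by move=> u; rewrite mule_ge0// lee_fin.
Qed.

(** The radii are dyadic and bounded by 2 ^ K, so that balls centred in the ball of radius 2 ^ K
    stay inside the ball of twice that radius. *)
Definition maxset F lam K : set X := \bigcup_(k in [set k | (k <= K)%N])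
  [set x | ((lam * bvol (2 ^+ k))%:E < orbint F (2 ^+ k) x)%E].

Lemma maxset_meas F lam K : measurable_fun setT F -> (forall y, 0 <= F y)%E ->
  measurable (maxset F lam K).
Proof.
move=> mF F0; apply: bigcup_measurable => k _.
rewrite -[X in measurable X]setTI; apply: emeasurable_fun_o_infty => //.
exact: (orbint_meas HG HA).
Qed.

(** The covering lemma is applied to u |-> F (u^-1 x). The centres are the g in the ball of radius 2
    ^ K with g^-1 x in [maxset]; by [orbint_translate] each carries a ball on which the integral is
    large. *)
Lemma maxset_orbint F lam K x : measurable_fun setT F -> (forall y, 0 <= F y)%E ->
  0 < lam ->
  (lam%:E * orbint (fun y => (\1_(maxset F lam K) y)%:E) (2 ^+ K) x
   <= C%:E * orbint F (2 * 2 ^+ K) x)%E.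
Proof.
move=> mF F0 lam0.
have mM := maxset_meas lam K mF F0.
pose Fam : set (G * nat) := [set p | [/\ (p.2 <= K)%N, B (2 ^+ K) p.1 &
  ((lam * bvol (2 ^+ p.2))%:E < orbint F (2 ^+ p.2) (act (inv p.1) x))%E]].
(* Enough units [bvol 1] to dominate the region, as the induction in [vitali_doubling] requires. *)
pose N := (Num.trunc (bvol (2 * 2 ^+ K) / bvol 1)).+1.
have hN : (m (B (2 * 2 ^+ K)) <= (N%:R * bvol 1)%:E)%E.
  rewrite (bvolE HG) lee_fin -ler_pdivrMr ?(bvol_gt0 HG)//.
  by rewrite ltW// truncnS_gt.
have hFam : forall g k, Fam (g, k) -> [/\ (k <= K)%N,
   cball d g (2 ^+ k) `<=` B (2 * 2 ^+ K) &
   ((lam * bvol (2 ^+ k))%:E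
     <= \int[m]_(u in cball d g (2 ^+ k)) F (act (inv u) x))%E].
  move=> g k [/= kK gB hg]; split => //.
    move=> u gu; rewrite /cball /= (le_trans (dist_tri HG one g u))//.
    rewrite mulr2n mulrDl mul1r lerD// (le_trans gu)//.
    by rewrite ler_eXn2l ?ltr1n.
  by rewrite -orbint_translate// ltW.
have [V [mV VF hV]] := vitali_doubling (orbit_meas HG HA x mF)
  (fun g => F0 _) lam0 (ball_meas HG _) hN hFam.
apply: (le_trans _ hV); rewrite lee_pmul2l//.
rewrite /orbit_int.
have mS : measurable [set g | maxset F lam K (act (inv g) x)].
  rewrite -[X in measurable X]setTI.
  by apply: (orbit_meas HG HA (F := id) x (@measurable_id _ _ _)).
rewrite (_ : (\int[m]_(g in B (2 ^+ K)) _)%E =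
  (\int[m]_(g in B (2 ^+ K)) (\1_[set g | maxset F lam K (act (inv g) x)] g)%:E)%E); last first.
  by [].
rewrite integral_indic//; last exact: (ball_meas HG).
apply: le_measure; rewrite ?inE//; first by apply: measurableI => //; exact: (ball_meas HG).
by move=> g [/= [k /= kK hk] gB]; apply: (VF g k); split.
Qed.

(** Integrate [maxset_orbint] over X: by [integral_orbint] the volumes of radius 2 ^ K and 2 * 2 ^ K
    appear on the two sides. Comparing them costs a second factor C. *)
Lemma maxset_bound F lam K : measurable_fun setT F -> (forall y, 0 <= F y)%E ->
  0 < lam -> (lam%:E * mu (maxset F lam K) <= (C ^+ 2)%:E * \int[mu]_x F x)%E.
Proof.
move=> mF F0 lam0; have mM := maxset_meas lam K mF F0.
have C1 := doubling_ge1; have C0 : 0 <= C by rewrite (le_trans _ C1).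
have K0 : 0 < 2 ^+ K :> R by rewrite exprn_gt0.
have m1 : measurable_fun setT (fun y => (\1_(maxset F lam K) y)%:E : \bar R).
  by apply/measurable_EFinP/measurable_indicP.
have p1 y : (0 <= (\1_(maxset F lam K) y)%:E :> \bar R)%E by rewrite lee_fin.
have : (\int[mu]_x (lam%:E * orbint (fun y => (\1_(maxset F lam K) y)%:E) (2 ^+ K) x)
        <= \int[mu]_x (C%:E * orbint F (2 * 2 ^+ K) x))%E.
  apply: ge0_le_integral => //.
  - move=> x _; apply: mule_ge0; first by rewrite lee_fin ltW.
    exact: orbint_ge0.
  - by apply: measurable_funeM; exact: (orbint_meas HG HA).
  - by apply: measurable_funeM; exact: (orbint_meas HG HA).
  - by move=> x _; exact: maxset_orbint.
have intZ a F' t : 0 <= a -> measurable_fun setT F' -> (forall y, 0 <= F' y)%E ->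
    (\int[mu]_x (a%:E * orbint F' t x) = a%:E * \int[mu]_x orbint F' t x)%E.
  move=> a0 mF' F'0; apply: ge0_integralZl_EFin => //.
    by move=> x _; exact: orbint_ge0.
  exact: (orbint_meas HG HA).
rewrite !intZ// ?(ltW lam0)//.
rewrite !(integral_orbint HG HA)// integral_indic// setIT muleCA => h.
rewrite -(@lee_pmul2l _ (bvol (2 ^+ K))%:E) ?lte_fin ?(bvol_gt0 HG)//.
apply: (le_trans h); rewrite !muleA; apply: lee_wpmul2r.
  exact: integral_ge0.
rewrite -!EFinM lee_fin.
have -> : bvol (2 ^+ K) * C ^+ 2 = C * (C * bvol (2 ^+ K)) by ring.
by rewrite ler_wpM2l// bvol_double.
Qed.

(** The sets [maxset] increase with K under a bound uniform in K, which passes to their union. A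
    radius t >= 1 lies between consecutive powers of 2, and passing to the larger one costs a factor
    C. *)
Lemma ergodic_maximal_inequality F lam : measurable_fun setT F ->
  (forall y, 0 <= F y)%E -> 0 < lam ->
  exists E, [/\ measurable E, (lam%:E * mu E <= (C ^+ 2)%:E * \int[mu]_x F x)%E &
    forall x, ~ E x -> forall t, 1 <= t ->
      (orbint F t x <= (C * lam * bvol t)%:E)%E].
Proof.
move=> mF F0 lam0.
exists (\bigcup_K maxset F lam K); split.
- by apply: bigcupT_measurable => K; exact: maxset_meas.
- rewrite muleC -lee_pdivlMr// muleC.
  have ndM : nondecreasing_seq (maxset F lam).
    move=> K L KL; apply/subsetPset => x [k /= kK hk]; exists k => //=.
    exact: leq_trans KL.
  have mU : measurable (\bigcup_K maxset F lam K).
    by apply: bigcupT_measurable => K; exact: maxset_meas.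
  have cv := nondecreasing_cvg_mu (mu := mu)
    (fun K => maxset_meas lam K mF F0) mU ndM.
  rewrite -(cvg_lim _ cv)//; apply: lime_le; first by apply/cvg_ex; eexists; exact: cv.
  apply: nearW => K /=; rewrite muleC lee_pdivlMr// muleC.
  exact: maxset_bound.
- move=> x nE t t1.
  have t0 : 0 < t by rewrite (lt_le_trans _ t1).
  have ext : exists k, t < 2 ^+ k.
    by exists (Num.bound t); exact: upper_nthrootP.
  (* The least exponent k with t < 2 ^ k is not 0 because 1 <= t, so its predecessor gives a power
     at most t. *)
  case: (ex_minnP ext) => -[|k]; first by rewrite expr0 ltNge t1.
  move=> tk /(_ k) kt; have {kt} kt : 2 ^+ k <= t.
    by rewrite leNgt; apply/negP => /kt; rewrite ltnn.
  have : ~ ((lam * bvol (2 ^+ k.+1))%:E < orbint F (2 ^+ k.+1) x)%E.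
    by move=> h; apply: nE; exists k.+1 => //; exists k.+1 => /=.
  move/negP; rewrite -leNgt => h.
  apply: (@le_trans _ _ (orbint F (2 ^+ k.+1) x)).
    apply: ge0_subset_integral => //; try exact: (ball_meas HG).
      exact: measurable_funTS (orbit_meas HG HA x mF).
    by move=> u /= ut; rewrite /cball /= (le_trans ut)// ltW.
  apply: (le_trans h); rewrite lee_fin -mulrA [leRHS]mulrCA ler_pM2l//.
  rewrite exprS (le_trans (bvol_double _)) ?exprn_gt0//.
  by rewrite ler_pM2l ?bvol_le// (lt_le_trans _ doubling_ge1).
Qed.

End Maximal.

(** * Coboundaries: asymptotic invariance makes their averages vanish uniformly *)

Section Coboundary.
Context {R : realType} {dG dX : measure_display}.
Context {G : measurableType dG} {X : measurableType dX}.
Variables (mul : G -> G -> G) (inv : G -> G) (one : G).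
Variable m : {sigma_finite_measure set G -> \bar R}.
Variables (d : G -> G -> R) (C : R).
Variables (mu : probability X R) (act : G -> X -> X).
Hypothesis HG : doubling_group mul inv one m d C.
Hypothesis HA : pmp_action mul mu act.

Local Notation B := (cball d one).
Local Notation bvol := (ball_vol one m d).
Local Notation orbint := (orbit_int inv one m d act).
Local Notation avg := (orbit_avg inv one m d act).
Implicit Types (s t : R) (f h : X -> R).

(** Uniformity in x gives convergence at every point and in mean at the same time. *)
Definition vanishing_avg f := bounded_meas f /\
  forall e : R, 0 < e -> \forall t \near +oo, forall x, `|avg f t x| <= e.

(** The proportion of the ball that right multiplication by v moves outside it. *)
Definition folner_defect t (v : G) : R :=
  fine (m (B t `\` [set g | B t (mul g v)])) / bvol t.

Lemma folner_set_meas t :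
  measurable [set q : G * G | B t q.1 /\ ~ B t (mul q.1 q.2)].
Proof.
apply: (@measurableD _ (G * G)%type (fst @^-1` B t)
    ((fun q : G * G => mul q.1 q.2) @^-1` B t)).
  by rewrite -[X in measurable X]setTI; apply: measurable_fst => //; exact: (ball_meas HG).
by rewrite -[X in measurable X]setTI; apply: (gmul_meas HG) => //; exact: (ball_meas HG).
Qed.

Lemma folner_defect_meas t : measurable_fun setT (folner_defect t).
Proof.
apply: measurable_funM => //; apply: measurableT_comp => //.
rewrite (_ : (fun _ => _) = m \o ysection [set q : G * G | B t q.1 /\ ~ B t (mul q.1 q.2)]).
  by apply: measurable_fun_ysection; exact: folner_set_meas.
apply/funext => v /=; congr (m _); apply/funext => g; apply/propext.
by rewrite /ysection /= inE.
Qed.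

Lemma folner_diff_meas t v : measurable (B t `\` [set g | B t (mul g v)]).
Proof.
have := measurable_ysection v (folner_set_meas t).
rewrite (_ : ysection _ v = B t `\` [set g | B t (mul g v)])//.
by apply/funext => g; apply/propext; rewrite /ysection /= inE.
Qed.

Lemma folner_diff_fin t v :
  m (B t `\` [set g | B t (mul g v)]) \is a fin_num.
Proof.
rewrite ge0_fin_numE ?measure_ge0//; apply: le_lt_trans (ball_lty HG t).
apply: le_measure; rewrite ?inE//; [exact: folner_diff_meas|exact: (ball_meas HG)].
Qed.

Lemma folner_defect_itv t v : 0 <= folner_defect t v <= 1.
Proof.
have v0 : 0 <= bvol t by rewrite fine_ge0.
rewrite divr_ge0 ?fine_ge0//=.
(* A ball of volume 0 has defect 0, since the inverse of 0 is 0. *)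
have [t0|t0] := eqVneq (bvol t) 0; first by rewrite /folner_defect t0 invr0 mulr0.
rewrite ler_pdivrMr ?lt_neqAle 1?eq_sym ?t0// mul1r fine_le ?folner_diff_fin//.
  by rewrite (bvolE HG).
apply: le_measure; rewrite ?inE//; [exact: folner_diff_meas|exact: (ball_meas HG)].
Qed.

(** Not divided by [bvol s]; that division appears in [coboundary_bound]. *)
Definition mean_defect s t : R := \int[m]_(v in B s) folner_defect t v.

(** The defects tend to 0 pointwise and are at most 1 on a ball of finite volume, so dominated
    convergence applies along every sequence of radii tending to infinity. *)
Lemma mean_defect_cvg s : mean_defect s t @[t --> +oo] --> 0.
Proof.
apply/cvg_pinftyP => u uoo; rewrite /mean_defect /Rintegral.
apply: fine_cvg.
have mB := ball_meas HG s.
have mf n : measurable_fun (B s) (fun v => (folner_defect (u n) v)%:E).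
  by apply/measurable_EFinP; exact: measurable_funTS (folner_defect_meas (u n)).
have cvf v : B s v -> (folner_defect (u n) v)%:E @[n --> \oo] --> (0 : R)%:E.
  move=> _; apply: cvg_EFin; first exact: nearW.
  by move: (ball_folner HG v) => /cvg_pinftyP /(_ u uoo).
have i1 : m.-integrable (B s) (cst 1%E).
  apply/integrableP; split => //.
  rewrite (eq_integral (cst 1%:E)); last by move=> v _; rewrite gee0_abs.
  by rewrite (integral_ball_cst HG) ltry.
have dom v n : B s v -> (`|(folner_defect (u n) v)%:E| <= cst 1 v)%E.
  move=> _; rewrite lee_fin.
  by have /andP[d0 d1] := folner_defect_itv (u n) v; rewrite ger0_norm.
have [_ _] := dominated_convergence mB mf (measurable_cst _) (aeW m cvf) i1 (aeW m dom).
by rewrite integral0.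
Qed.

(** The relation is the preimage of a ball under (g, u) |-> g^-1 u. *)
Lemma dist_meas2 s : measurable [set q : G * G | d q.1 q.2 <= s].
Proof.
rewrite (_ : mkset _ = (fun q : G * G => mul (inv q.1) q.2) @^-1` B s).
  rewrite -[X in measurable X]setTI.
  have h : measurable_fun setT (fun q : G * G => (inv q.1, q.2)).
    by apply: measurable_fun_pair => //; exact: measurableT_comp (ginv_meas HG) _.
  apply: (measurableT_comp (gmul_meas HG) h) => //; exact: (ball_meas HG).
apply/funext => -[g u] /=; rewrite -[LHS]/(cball d g s u).
by rewrite (cball_translate HG).
Qed.

(** The kernel of the relation d g u <= s with u confined to A; A will be the whole group, a ball or
    the complement of a ball. *)
Let k (A : set G) s g u : R := \1_A u * \1_(cball d g s) u.

Let k_meas A s : measurable A ->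
  measurable_fun setT (fun q : G * G => k A s q.1 q.2).
Proof.
move=> mA; apply: measurable_funM.
  by apply: (measurableT_comp _ measurable_snd); exact/measurable_indicP.
rewrite (_ : (fun _ => _) = \1_[set q : G * G | d q.1 q.2 <= s]); last first.
  by apply/funext => -[g u]; rewrite !indicE; congr ((_ : bool)%:R);
    apply/idP/idP; rewrite !inE.
by apply/measurable_indicP; exact: dist_meas2.
Qed.

Let k_ge0 A s g u : 0 <= k A s g u.
Proof. by rewrite mulr_ge0. Qed.

(** For fixed g the substitution u = g v preserves [m] and turns the kernel into the conditions v in
    B_s and g v outside B_t. Exchanging the integrals leaves, for each v, the measure of the g in
    B_t that v moves out. *)
Lemma outer_mass s t : 0 < t ->
  (\int[m]_(g in B t) \int[m]_u (k (~` B t) s g u)%:E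
   = (bvol t * mean_defect s t)%:E)%E.
Proof.
move=> t0; have mB := ball_meas HG.
transitivity (\int[m]_g \int[m]_v
    (\1_[set q : G * G | B t q.1 /\ ~ B t (mul q.1 q.2)] (g, v) * \1_(B s) v)%:E)%E.
  rewrite integral_indic_mull; apply: eq_integral => g _.
  rewrite -ge0_integralZl//; last 2 first.
  - apply/measurable_EFinP.
    exact: (measurableT_comp (k_meas s (measurableC (mB t))) (pair1_measurable g)).
  - by move=> u _; rewrite lee_fin.
  rewrite -(ge0_integral_preserving (gmulr_meas HG g) (haar_mul HG g)); last 2 first.
  - apply: measurable_funeM; apply/measurable_EFinP.
    exact: (measurableT_comp (k_meas s (measurableC (mB t))) (pair1_measurable g)).
  - by move=> u; rewrite mule_ge0// lee_fin.
  apply: eq_integral => v _; rewrite -EFinM /k mulrA; congr (_ * _)%:E.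
    rewrite !indicE -natrM mulnb; congr ((_ : bool)%:R).
    by apply/andP/idP; rewrite !inE.
  rewrite !indicE; congr ((_ : bool)%:R); apply/idP/idP; rewrite !inE /cball /=;
  by rewrite -{1}(gmulg1 HG g) (dist_mul HG).
rewrite (fubini_tonelli (m1 := m) (m2 := m) (fun q : G * G =>
    (\1_[set q : G * G | B t q.1 /\ ~ B t (mul q.1 q.2)] q * \1_(B s) q.2)%:E)); last 2 first.
- apply/measurable_EFinP; apply: measurable_funM.
    by apply/measurable_indicP; exact: folner_set_meas.
  by apply: (measurableT_comp _ measurable_snd); exact/measurable_indicP.
- by move=> q; rewrite lee_fin mulr_ge0.
have Ifd : m.-integrable (B s) (EFin \o folner_defect t).
  apply: measurable_bounded_integrable => //.
  - exact: (ball_lty HG).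
  - exact: measurable_funTS (folner_defect_meas t).
  - exists 1; split => // y y1 v _ /=.
    have /andP[d0 d1] := folner_defect_itv t v.
    by rewrite ger0_norm// (le_trans d1)// ltW.
have -> : (bvol t * mean_defect s t)%:E
    = ((bvol t)%:E * \int[m]_(v in B s) (folner_defect t v)%:E)%E.
  rewrite EFinM; congr (_ * _)%E; rewrite /mean_defect /Rintegral fineK//.
  exact: (integrable_fin_num (mB s) Ifd).
rewrite -integralZl// [RHS]integral_indic_mull; apply: eq_integral => v _.
under eq_integral do rewrite mulrC EFinM.
rewrite /=.
rewrite ge0_integralZl//; last first.
  apply/measurable_EFinP; apply: (measurableT_comp _ (pair2_measurable v)).
  by apply/measurable_indicP; exact: folner_set_meas.
congr (_ * _)%E; rewrite /folner_defect -EFinM mulrCA divff ?gt_eqF ?(bvol_gt0 HG)//.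
rewrite mulr1 fineK ?folner_diff_fin//.
rewrite -[in RHS](setIT (B t `\` _)) -integral_indic//; last exact: folner_diff_meas.
Qed.

(** Multiplied by the two volumes, the averages become integrals of one kernel weighted by h (g^-1
    x) and by h (u^-1 x). As 0 <= h <= M, both excess terms lie in one interval starting at 0, which
    gives the constant M rather than 2 M. *)
Lemma coboundary_bound h M s t x : 0 < s -> 0 < t ->
  measurable_fun setT h -> (forall y, 0 <= h y <= M) ->
  `|avg h t x - avg (avg h s) t x| <= M * mean_defect s t / bvol s.
Proof.
move=> s0 t0 mh hM; have mB := ball_meas HG.
have bh : bounded_meas h.
  split => //; exists M => y; have /andP[h0 h1] := hM y; by rewrite ger0_norm.
have M0 : 0 <= M by have /andP[/le_trans] := hM x; apply.
pose H u := h (act (inv u) x).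
have H0 u : 0 <= H u by have /andP[] := hM (act (inv u) x).
have HM u : H u <= M by have /andP[] := hM (act (inv u) x).
have mH : measurable_fun setT H by exact: (orbit_meas HG HA).
have mk1 A g : measurable A -> measurable_fun setT (k A s g).
  by move=> mA; exact: (measurableT_comp (k_meas s mA) (pair1_measurable g)).
(* Both averages differ from the symmetric integral J over B_t * B_t only by
   the mass of the pairs (g, u) with g in B_t, u outside B_t, d g u <= s. *)
pose L (A : set G) (w : G -> G -> R) :=
  (\int[m]_(g in B t) \int[m]_u (k A s g u * w g u)%:E)%E.
have mL (A : set G) (w : G -> G -> R) : measurable A ->
    measurable_fun setT (fun q : G * G => w q.1 q.2) ->
    measurable_fun setT (fun q : G * G => (k A s q.1 q.2 * w q.1 q.2)%:E).
  by move=> mA mw; apply/measurable_EFinP; apply: measurable_funM => //; exact: k_meas.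
have mLi (A : set G) (w : G -> G -> R) : measurable A ->
    measurable_fun setT (fun q : G * G => w q.1 q.2) ->
    (forall g u, 0 <= w g u) ->
    measurable_fun setT (fun g => \int[m]_u (k A s g u * w g u)%:E)%E.
  move=> mA mw w0.
  apply: (@measurable_fun_fubini_tonelli_F _ _ G G R m
    (fun q : G * G => (k A s q.1 q.2 * w q.1 q.2)%:E) (mL A w mA mw)).
  by move=> q; rewrite lee_fin mulr_ge0.
have Lsplit (w : G -> G -> R) : measurable_fun setT (fun q : G * G => w q.1 q.2) ->
    (forall g u, 0 <= w g u) -> L setT w = (L (B t) w + L (~` B t) w)%E.
  move=> mw w0; have mBC := measurableC (mB t).
  rewrite /L -ge0_integralD//; last 4 first.
  - by move=> g _; apply: integral_ge0 => u _; rewrite lee_fin mulr_ge0.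
  - exact: measurable_funTS (mLi _ _ _ _ _).
  - by move=> g _; apply: integral_ge0 => u _; rewrite lee_fin mulr_ge0.
  - exact: measurable_funTS (mLi _ _ _ _ _).
  apply: eq_integral => g _; rewrite -ge0_integralD//; last 4 first.
  - by move=> u _; rewrite lee_fin mulr_ge0.
  - exact: (measurableT_comp (mL _ _ (mB t) mw) (pair1_measurable g)).
  - by move=> u _; rewrite lee_fin mulr_ge0.
  - exact: (measurableT_comp (mL _ _ mBC mw) (pair1_measurable g)).
  apply: eq_integral => u _; rewrite -EFinD -mulrDl; congr (_ * _)%:E.
  rewrite /k -mulrDl; congr (_ * _); rewrite !indicE in_setT in_setC.
  by case: (u \in B t); rewrite /= ?addr0 ?add0r.
have LM (w : G -> G -> R) : measurable_fun setT (fun q : G * G => w q.1 q.2) ->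
    (forall g u, 0 <= w g u <= M) ->
    (L (~` B t) w <= (M * (bvol t * mean_defect s t))%:E)%E.
  move=> mw wM; have mBC := measurableC (mB t).
  have w0 g u : 0 <= w g u by have /andP[] := wM g u.
  rewrite EFinM -outer_mass// -ge0_integralZl//; last 2 first.
  - apply: measurable_funTS; rewrite (_ : (fun _ => _) =
      (fun g => \int[m]_u (k (~` B t) s g u * cst 1 u)%:E)%E).
      exact: (mLi _ (fun g u => 1)).
    by apply/funext => g; apply: eq_integral => u _; rewrite mulr1.
  - by move=> g _; apply: integral_ge0 => u _; rewrite lee_fin.
  apply: ge0_le_integral => //.
  - by move=> g _; apply: integral_ge0 => u _; rewrite lee_fin mulr_ge0.
  - exact: measurable_funTS (mLi _ _ _ _ _).
  - apply: measurable_funeM; apply: measurable_funTS; rewrite (_ : (fun _ => _) =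
      (fun g => \int[m]_u (k (~` B t) s g u * cst 1 u)%:E)%E).
      exact: (mLi _ (fun g u => 1)).
    by apply/funext => g; apply: eq_integral => u _; rewrite mulr1.
  move=> g _; rewrite -ge0_integralZl//; last 2 first.
  - by apply/measurable_EFinP; exact: mk1.
  - by move=> u _; rewrite lee_fin.
  apply: ge0_le_integral => //.
  - by move=> u _; rewrite lee_fin mulr_ge0.
  - exact: (measurableT_comp (mL _ _ mBC mw) (pair1_measurable g)).
  - by apply: measurable_funeM; apply/measurable_EFinP; exact: mk1.
  by move=> u _; rewrite lee_fin mulrC ler_wpM2r//; have /andP[] := wM g u.
have m1 : measurable_fun setT (fun q : G * G => H q.1).
  exact: (measurableT_comp mH measurable_fst).
have m2 : measurable_fun setT (fun q : G * G => H q.2).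
  exact: (measurableT_comp mH measurable_snd).
(* Every ball of radius s has volume [bvol s], so integrating the kernel over u returns this
   factor. *)
have I1 : (bvol s * (bvol t * avg h t x))%:E = L setT (fun g u => H g).
  rewrite EFinM (avgE HG HA)// -ge0_integralZl//; last 3 first.
  - by apply/measurable_EFinP; exact: measurable_funTS.
  - by move=> g _; rewrite lee_fin; exact: H0.
  - by rewrite lee_fin ltW// (bvol_gt0 HG).
  apply: eq_integral => g _; under [RHS]eq_integral do rewrite mulrC EFinM.
  rewrite ge0_integralZl//; last 3 first.
  - by apply/measurable_EFinP; exact: mk1.
  - by move=> u _; rewrite lee_fin.
  - by rewrite lee_fin.
  rewrite muleC; congr (_ * _)%E; rewrite -(cball_vol HG g) -[in LHS](setIT (cball d g s)).
  rewrite -integral_indic//; last exact: (cball_meas HG).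
  by apply: eq_integral => u _; rewrite /k indicT mul1r.
(* By [orbint_translate] the inner average at g^-1 x is an integral over the ball of centre g. *)
have I2 : (bvol s * (bvol t * avg (avg h s) t x))%:E = L setT (fun g u => H u).
  rewrite EFinM (avgE HG HA)//; last exact: (avg_bounded HG HA).
  rewrite -ge0_integralZl//; last 3 first.
  - apply/measurable_EFinP; apply: measurable_funTS.
    exact: (orbit_meas HG HA x (avg_meas HG HA s mh)).
  - move=> g _; rewrite lee_fin divr_ge0 ?fine_ge0//.
    by apply: integral_ge0 => u _; rewrite lee_fin; have /andP[] := hM (act (inv u) (act (inv g) x)).
  - by rewrite lee_fin ltW// (bvol_gt0 HG).
  apply: eq_integral => g _; rewrite -EFinM (avgE HG HA)//.
  rewrite -[LHS]/(orbint (EFin \o h) s (act (inv g) x)) (orbint_translate HG HA)//; last 2 first.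
  - exact/measurable_EFinP.
  - by move=> y /=; rewrite lee_fin; have /andP[] := hM y.
  rewrite integral_indic_mull; apply: eq_integral => u _.
  by rewrite /k indicT mul1r EFinM.
(* With both points in B_t the kernel is symmetric, because d is; exchanging the integrals swaps the
   weights. *)
have J : L (B t) (fun g u => H g) = L (B t) (fun g u => H u).
  rewrite /L integral_indic_mull.
  transitivity (\int[m]_g \int[m]_u ((\1_(B t) g)%:E * (k (B t) s g u * H g)%:E))%E.
    apply: eq_integral => g _; rewrite ge0_integralZl//.
    - exact: (measurableT_comp (mL (B t) (fun g u => H g) (mB t) m1) (pair1_measurable g)).
    - by move=> u _; rewrite lee_fin mulr_ge0.
  rewrite (fubini_tonelli (m1 := m) (m2 := m) (fun q : G * G =>
    ((\1_(B t) q.1)%:E * (k (B t) s q.1 q.2 * H q.1)%:E)%E)); last 2 first.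
  - apply: emeasurable_funM; last exact: (mL (B t) (fun g u => H g) (mB t) m1).
    apply/measurable_EFinP; apply: (measurableT_comp _ measurable_fst).
    exact/measurable_indicP.
  - by move=> q; rewrite mule_ge0// lee_fin// mulr_ge0.
  rewrite [RHS]integral_indic_mull; apply: eq_integral => u _ /=.
  rewrite -ge0_integralZl//; last 2 first.
  - exact: (measurableT_comp (mL (B t) (fun g u => H u) (mB t) m2) (pair1_measurable u)).
  - by move=> g _; rewrite lee_fin mulr_ge0.
  apply: eq_integral => g _; rewrite -!EFinM /k; congr (_%:E).
  have -> : \1_(cball d g s) u = \1_(cball d u s) g :> R.
    by rewrite !indicE; congr ((_ : bool)%:R); apply/idP/idP; rewrite !inE /cball /= (distC HG).
  by rewrite !mulrA; congr (_ * _ * _); rewrite mulrC.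
have J0 : (0 <= L (B t) (fun g u => H u))%E.
  by apply: integral_ge0 => g _; apply: integral_ge0 => u _; rewrite lee_fin mulr_ge0.
have e1 := LM (fun g u => H g) m1 (fun g u => hM (act (inv g) x)).
have e2 := LM (fun g u => H u) m2 (fun g u => hM (act (inv u) x)).
have p1 : (0 <= L (~` B t) (fun g u => H g))%E.
  by apply: integral_ge0 => g _; apply: integral_ge0 => u _; rewrite lee_fin mulr_ge0.
have p2 : (0 <= L (~` B t) (fun g u => H u))%E.
  by apply: integral_ge0 => g _; apply: integral_ge0 => u _; rewrite lee_fin mulr_ge0.
move: I1 I2; rewrite !Lsplit// J.
(* All terms are nonnegative and are either bounded or summands of a real number, hence real; the
   common term then cancels. *)
case: (L (~` B t) (fun g u => H g)) e1 p1 => [a| |]//; rewrite !lee_fin => e1 p1.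
case: (L (~` B t) (fun g u => H u)) e2 p2 => [b| |]//; rewrite !lee_fin => e2 p2.
case: (L (B t) _) J0 => [j| |]// _.
move=> [E1] [E2].
have vs := bvol_gt0 HG s0; have vt := bvol_gt0 HG t0.
have P0 : 0 < bvol s * bvol t by rewrite mulr_gt0.
rewrite -(ler_pM2l P0) -{1}(gtr0_norm P0) -normrM.
have -> : bvol s * bvol t * (avg h t x - avg (avg h s) t x) = a - b.
  by rewrite mulrBr -!mulrA E1 E2; ring.
have -> : bvol s * bvol t * (M * mean_defect s t / bvol s) = M * (bvol t * mean_defect s t).
  by field; rewrite gt_eqF.
by rewrite ler_norml; apply/andP; split; lra.
Qed.

Lemma vanishing_coboundary h s : 0 < s -> bounded_meas h ->
  vanishing_avg (fun x => h x - avg h s x).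
Proof.
move=> s0 bh; have [mh [M hM]] := bh.
have bA := avg_bounded HG HA s0 bh.
have bq : bounded_meas (fun x => h x - avg h s x).
  rewrite (_ : (fun _ => _) = (fun x => 1 * h x + (-1) * avg h s x)).
    exact: bounded_meas_lin.
  by apply/funext => x; rewrite mul1r mulN1r.
split => // e e0.
have M0 : 0 <= M by rewrite (le_trans _ (hM point)).
(* [coboundary_bound] wants values in an interval starting at 0. Adding M puts them in [0, 2 M], and
   constants cancel in h - A_s h. *)
pose h' := (fun y => 1 * h y + M * cst 1 y).
have bc := bounded_meas_cst (X := X) (1 : R).
have h'E t x : 0 < t -> avg h' t x = avg h t x + M.
  by move=> t0; rewrite /h' (avg_lin HG HA)// (avg_cst act HG)// mul1r mulr1.
have mh' : measurable_fun setT h' by case: (bounded_meas_lin 1 M bh bc).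
have h'M y : 0 <= h' y <= 2 * M.
  rewrite /h' /cst mul1r mulr1; have := hM y; rewrite ler_norml => /andP[? ?].
  by apply/andP; split; lra.
have cv : 2 * M * mean_defect s t / bvol s @[t --> +oo] --> 0.
  rewrite [X in _ --> X](_ : 0 = 2 * M * 0 / bvol s); last by rewrite mulr0 mul0r.
  by apply: cvgM; [apply: cvgM; [exact: cvg_cst|exact: mean_defect_cvg]|exact: cvg_cst].
near=> t.
have small : `|2 * M * mean_defect s t / bvol s| <= e.
  by near: t; move/cvgr0_norm_le : cv; apply.
have t0 : 0 < t by near: t; exact: nbhs_pinfty_gt.
move=> x.
have -> : avg (fun x => h x - avg h s x) t x = avg h' t x - avg (avg h' s) t x.
  have -> : avg h' s = (fun y => 1 * avg h s y + M * cst 1 y).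
    by apply/funext => y; rewrite h'E// mul1r mulr1.
  rewrite h'E// [in RHS](avg_lin HG HA)// (avg_cst act HG)// mul1r mulr1.
  rewrite (_ : (fun x => h x - _) = (fun x => 1 * h x + (-1) * avg h s x)); last first.
    by apply/funext => y; rewrite mul1r mulN1r.
  by rewrite (avg_lin HG HA)//; ring.
rewrite (le_trans (coboundary_bound _ s0 t0 mh' h'M))//.
exact: le_trans (ler_norm _) small.
Unshelve. all: by end_near. Qed.

End Coboundary.

(** * Completeness of L1, and functions that are constant almost everywhere *)

Lemma L1_complete d (T : measurableType d) (R : realType)
    (mu : {measure set T -> \bar R}) (u : nat -> T -> R) (c : R) :
  (forall n, measurable_fun setT (u n)) ->
  (forall n, (\int[mu]_x (`|u n x - u n.+1 x|)%:E <= (c * 2^-1 ^+ n)%:E)%E) ->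
  exists v : T -> R, measurable_fun setT v /\
    forall n, (\int[mu]_x (`|u n x - v x|)%:E <= (2 * c * 2^-1 ^+ n)%:E)%E.
Proof.
move=> mu_ hu.
have c0 : 0 <= c.
  have := le_trans (integral_ge0 _ _) (hu 0%N); rewrite expr0 mulr1 lee_fin; apply.
  by move=> x _; rewrite lee_fin.
(* The limsup is measurable on all of [T] and equals the limit wherever the increments are
   summable. *)
pose v x := fine (limn_esup (fun n => (u n x)%:E)).
have mv : measurable_fun setT v.
  apply: measurableT_comp => //; apply: measurable_fun_limn_esup => n.
  exact/measurable_EFinP.
exists v; split => // n.
pose w k x := (`|u (n + k)%N x - u (n + k).+1 x|)%:E : \bar R.
have w0 k x : (0 <= w k x)%E by rewrite lee_fin.
have mw k : measurable_fun setT (w k).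
  by apply/measurable_EFinP; apply: measurableT_comp => //; exact: measurable_funB.
have ptw x : ((`|u n x - v x|)%:E <= \sum_(k <oo) w k x)%E.
  have S0 : (0 <= \sum_(k <oo) w k x)%E by exact: nneseries_ge0.
  (* Where the increments are not summable the bound is +oo; elsewhere telescoping yields the
     limit. *)
  case E : (\sum_(k <oo) w k x)%E S0 => [S| |]// _; last by rewrite leey.
  pose y k := u (n + k)%N x.
  have bd K : \sum_(0 <= k < K) `|telescope y k| <= S.
    rewrite -lee_fin -E -sumEFin.
    rewrite (eq_bigr (w ^~ x)); last first.
      by move=> k _; rewrite /w /telescope /= /y addnS distrC.
    exact: nneseries_lim_ge.
  have cvy : cvgn (series (telescope y)).
    apply: normed_cvg; apply: nondecreasing_is_cvgn.
      by apply: nondecreasing_series => k _ _; exact: normr_ge0.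
    by exists S => _ [K _ <-]; exact: bd.
  have yE K : y K = y 0%N + series (telescope y) K.
    by rewrite seriesEord/= -(big_mkord xpredT) telescope_sumr// addrC subrK.
  have {}cvy : y K @[K --> \oo] --> y 0%N + limn (series (telescope y)).
    rewrite (_ : (fun K => y K) = (fun K => y 0%N + series (telescope y) K)).
      by apply: cvgD => //; exact: cvg_cst.
    by apply/funext => K.
  set l := _ + _ in cvy.
  have cvu : u K x @[K --> \oo] --> l.
    rewrite -(cvg_shiftn n); under eq_fun do rewrite addnC; exact: cvy.
  have -> : v x = l.
    rewrite /v is_cvg_limn_esupE; last by apply/cvg_ex; exists l%:E; exact: cvg_EFin (nearW _ _) cvu.
    by rewrite (cvg_lim _ (cvg_EFin (nearW _ _) cvu)).
  rewrite lee_fin.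
  have cvn : `|y 0%N - y K| @[K --> \oo] --> `|u n x - l|.
    apply: cvg_norm; rewrite -[u n x](_ : y 0%N = _); last by rewrite /y addn0.
    by apply: cvgB => //; exact: cvg_cst.
  rewrite -(cvg_lim _ cvn)//; apply: limr_le; first by apply/cvg_ex; eexists; exact: cvn.
  apply: nearW => K; apply: le_trans (bd K).
  rewrite distrC yE addrAC subrr add0r /series /=; exact: ler_norm_sum.
apply: (@le_trans _ _ (\int[mu]_x \sum_(k <oo) w k x)%E).
  apply: ge0_le_integral => //.
  - by apply/measurable_EFinP; apply: measurableT_comp => //; exact: measurable_funB.
  - exact: ge0_emeasurable_sum.
rewrite integral_nneseries//.
apply: lime_le.
  by apply: is_cvg_nneseries => k _ _; exact: integral_ge0.
apply: nearW => K /=.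
(* The partial geometric sum in closed form, so that the induction on K goes through. *)
suff /le_trans : (\sum_(0 <= k < K) \int[mu]_x w k x
    <= (2 * c * 2^-1 ^+ n * (1 - 2^-1 ^+ K))%:E)%E.
  by apply; rewrite lee_fin ler_piMr// ?gerBl ?mulr_ge0 ?exprn_ge0.
elim: K => [|K IH]; first by rewrite big_nil expr0 subrr mulr0.
rewrite big_nat_recr//=; apply: le_trans (leeD IH (hu (n + K)%N)) _.
rewrite -EFinD lee_fin le_eqVlt; apply/orP; left; apply/eqP.
by rewrite exprS exprD; field.
Qed.

Lemma measurable_sublevel d (T : measurableType d) (R : realType) (f : T -> R) c :
  measurable_fun setT f -> measurable [set x | f x <= c].
Proof.
move=> mf; rewrite (_ : mkset _ = setT `&` f @^-1` [set` `]-oo, c]]).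
  by apply: mf => //; exact: measurable_itv.
by rewrite setTI; apply/funext => x; rewrite /= in_itv.
Qed.

Lemma measurable_level d (T : measurableType d) (R : realType) (f : T -> R) c :
  measurable_fun setT f -> measurable [set x | f x = c].
Proof.
move=> mf; rewrite (_ : mkset _ = setT `&` f @^-1` [set c]).
  by apply: mf => //; exact: measurable_set1.
by rewrite setTI.
Qed.

Lemma ae_absurd d (T : measurableType d) (R : realType) (P : probability T R) :
  ~ {ae P, forall x : T, False}.
Proof.
move=> [N [mN N0 sub]].
have : (P setT <= P N)%E.
  by apply: le_measure; rewrite ?inE// => x _; exact: sub.
by rewrite probability_setT N0 lee_fin ler10.
Qed.

(** The constant is the supremum of the levels that r exceeds almost everywhere. It is finite
    because r is real valued: otherwise almost every r x would lie below every - n or above every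
    n. *)
Lemma zero_one_levels_cst d (T : measurableType d) (R : realType)
    (P : probability T R) (r : T -> R) :
  (forall c, {ae P, forall x, c < r x} \/ {ae P, forall x, r x <= c}) ->
  exists c, {ae P, forall x, r x = c}.
Proof.
move=> dich; pose A := [set c | {ae P, forall x, c < r x}].
have Aub : has_sup A.
  split.
    apply: contrapT => nA.
    apply: (@ae_absurd _ _ _ P).
    have h n : {ae P, forall x, r x <= - n%:R}.
      by case: (dich (- n%:R)) => // h; case: nA; exists (- n%:R).
    apply: filterS (ae_foralln h) => x hx.
    have := hx (Num.trunc `|r x|).+1; apply/negP; rewrite -ltNge ltrNl.
    by apply: le_lt_trans (truncnS_gt _); rewrite -normrN ler_norm.
  apply: contrapT => nA.
  apply: (@ae_absurd _ _ _ P).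
  have h n : {ae P, forall x, n%:R < r x}.
    apply: contrapT => hn; apply: nA; exists n%:R => c Ac.
    rewrite leNgt; apply/negP => nc; apply: hn.
    by apply: filterS Ac => x; exact: lt_trans.
  apply: filterS (ae_foralln h) => x hx.
  have := hx (Num.trunc `|r x|).+1; apply/negP; rewrite -leNgt.
  by apply: le_trans (ltW (truncnS_gt _)); exact: ler_norm.
exists (sup A).
have h1 n : {ae P, forall x, sup A - n.+1%:R^-1 < r x}.
  have n0 : 0 < n.+1%:R^-1 :> R by rewrite invr_gt0.
  have [c Ac lc] := sup_adherent n0 Aub.
  by apply: filterS Ac => x; exact: lt_trans.
have h2 n : {ae P, forall x, r x <= sup A + n.+1%:R^-1}.
  case: (dich (sup A + n.+1%:R^-1)) => // h.
  have := ub_le_sup Aub.2 (h : A _); rewrite gerDl leNgt.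
  by rewrite invr_gt0 ltr0n.
apply: filterS2 (ae_foralln h1) (ae_foralln h2) => x x1 x2.
apply/eqP; rewrite eq_le; apply/andP; split; apply/ler_addgt0Pl => e e0.
  have := x2 (Num.trunc e^-1); move=> /le_trans; apply; rewrite addrC lerD2r.
  by rewrite invf_ple ?posrE// ltW// truncnS_gt.
have := x1 (Num.trunc e^-1); rewrite ltrBlDr => /ltW/le_trans; apply.
by rewrite addrC lerD2r invf_ple ?posrE// ltW// truncnS_gt.
Qed.

(** * Invariant functions of an ergodic action *)

Section Ergodic.
Context {R : realType} {dG dX : measure_display}.
Context {G : measurableType dG} {X : measurableType dX}.
Variables (mul : G -> G -> G) (inv : G -> G) (one : G).
Variable m : {sigma_finite_measure set G -> \bar R}.
Variables (d : G -> G -> R) (C : R).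
Variables (mu : probability X R) (act : G -> X -> X).
Hypothesis HG : doubling_group mul inv one m d C.
Hypothesis HA : pmp_action mul mu act.

Local Notation B := (cball d one).
Local Notation orbint := (orbit_int inv one m d act).
Implicit Types (s t : R) (r : X -> R).

(** Invariance along the orbit in integrated form: if this is 0 for every s, then r (g^-1 x) = r x
    for almost every g. *)
Definition orbit_osc r s x : \bar R := orbint (fun y => (`|r x - r y|)%:E) s x.

(** The integrand depends on x through r x as well, so [orbint_meas] does not apply and joint
    measurability is established directly. *)
Lemma orbit_osc_meas r s : measurable_fun setT r ->
  measurable_fun setT (orbit_osc r s).
Proof.
move=> mr.
have mF : measurable_fun setT (fun q : G * X =>
    (\1_(B s) q.1)%:E * (`|r q.2 - r (act (inv q.1) q.2)|)%:E)%E.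
  apply: emeasurable_funM; apply/measurable_EFinP.
    apply: (measurableT_comp _ measurable_fst).
    by apply/measurable_indicP; exact: (ball_meas HG).
  apply: measurableT_comp => //; apply: measurable_funB.
    exact: (measurableT_comp mr measurable_snd).
  exact: (orbit_meas2 HG HA mr).
rewrite (_ : orbit_osc r s = fubini_G m (fun q : G * X =>
    (\1_(B s) q.1)%:E * (`|r q.2 - r (act (inv q.1) q.2)|)%:E)%E).
  by apply: measurable_fun_fubini_tonelli_G => // q; rewrite mule_ge0// lee_fin.
by apply/funext => x; rewrite /orbit_osc /orbit_int integral_indic_mull.
Qed.

Lemma ball_exhaust g : exists n : nat, B n.+1%:R g.
Proof.
exists (Num.trunc (d one g)); rewrite /cball /= ltW// truncnS_gt//.
Qed.

(** [ergodic_action] speaks of strictly invariant sets, whereas the set r > c is known to be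
    invariant only up to null sets. It is replaced by the set of the x with r (g^-1 x) > c for
    almost every g, which is strictly invariant by left invariance of [m] and differs from the
    former by a null set. *)
Lemma osc0_cst r : ergodic_action mu act -> measurable_fun setT r ->
  (forall s, 0 < s -> (\int[mu]_x orbit_osc r s x = 0)%E) ->
  exists c, {ae mu, forall x, r x = c}.
Proof.
move=> erg mr osc0; apply: zero_one_levels_cst => c.
have mle : measurable [set q : G * X | r (act (inv q.1) q.2) <= c].
  exact: measurable_sublevel (orbit_meas2 HG HA mr).
pose N x := [set g | r (act (inv g) x) <= c].
have mN x : measurable (N x).
  have := measurable_ysection x mle.
  by congr (measurable _); apply/funext => g; apply/propext; rewrite /ysection /= inE.
pose A := [set x | m (N x) = 0%E].
have mA : measurable A.
  have mf : measurable_fun setT (fun x => m (N x)).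
    rewrite (_ : (fun _ => _) = m \o ysection [set q : G * X | r (act (inv q.1) q.2) <= c]).
      exact: measurable_fun_ysection.
    apply/funext => x /=; congr (m _); apply/funext => g; apply/propext.
    by rewrite /ysection /= inE.
  rewrite (_ : A = setT `&` (fun x => m (N x)) @^-1` [set 0%E]); last first.
    by rewrite setTI.
  by apply: mf => //; exact: emeasurable_set1.
have Ainv g : act g @^-1` A = A.
  apply/funext => x; apply/propext; rewrite /A /=.
  rewrite (_ : N (act g x) = mul (inv g) @^-1` N x) ?(haar_mul HG)//.
  apply/funext => h; rewrite /N /= (ginvM HG) (actM HA).
  by congr (is_true (r (act _ (act _ x)) <= c)); rewrite -[LHS](gmulg1 HG)
    -(gmulgV HG (inv g)) (gmulA HG) (gmulgV HG) (gmul1 HG).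
have good : {ae mu, forall x, A x <-> c < r x}.
  have h n : {ae mu, forall x, orbit_osc r n.+1%:R x = 0%E}.
    have [h _] := ae_eq_integral_abs mu measurableT (orbit_osc_meas n.+1%:R mr).
    suff /h : (\int[mu]_x `|orbit_osc r n.+1%:R x| = 0)%E.
      by apply: filterS => x /(_ I).
    rewrite -[RHS](osc0 n.+1%:R)//; apply: eq_integral => x _.
    by rewrite gee0_abs// orbint_ge0// => y; rewrite lee_fin.
  apply: filterS (ae_foralln h) => x hx.
  (* The oscillation at x is 0 over the balls of all positive integer radii, and these exhaust the
     group. *)
  have Z0 : m (~` [set g | r (act (inv g) x) = r x]) = 0%E.
    have mZ : measurable (~` [set g | r (act (inv g) x) = r x]).
      apply: measurableC; exact: measurable_level (orbit_meas HG HA x mr).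
    apply/negligibleP => //.
    have ng n : m.-negligible (B n.+1%:R `&` ~` [set g | r (act (inv g) x) = r x]).
      have := hx n; rewrite /orbit_osc /orbit_int => h0.
      have : (\int[m]_(g in B n.+1%:R) `|(`|r x - r (act (inv g) x)|)%:E| = 0)%E.
        by rewrite -h0; apply: eq_integral => g _; rewrite gee0_abs// lee_fin.
      have mf : measurable_fun (B n.+1%:R) (fun g => (`|r x - r (act (inv g) x)|)%:E).
        apply/measurable_EFinP; apply: measurable_funTS; apply: measurableT_comp => //.
        by apply: measurable_funB => //; exact: (orbit_meas HG HA).
      have [hae _] := ae_eq_integral_abs m (ball_meas HG _) mf.
      move=> /hae [Z [mZ' Z0 sub]]; exists Z; split => // g [Bg ng]; apply: sub => /=.
      move=> /(_ Bg) [] /eqP; rewrite normr_eq0 subr_eq0 => /eqP e.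
      exact: ng.
    apply: negligibleS (negligible_bigcup ng) => g ng'.
    by have [n Bn] := ball_exhaust g; exists n.
  have mT : (0 < m setT)%E.
    apply: (lt_le_trans (ball_gt0 HG ltr01)).
    by apply: le_measure; rewrite ?inE//; exact: (ball_meas HG).
  split => [Ax|cr].
    rewrite ltNge; apply/negP => rc.
    (* If r x <= c, the group is the union of the null set [N x] and the exceptional null set,
       although its measure is positive. *)
    have : (m setT <= m (N x) + m (~` [set g | r (act (inv g) x) = r x]))%E.
      apply: le_trans (measureU2 _ _ _) => //; last first.
        apply: measurableC; exact: measurable_level (orbit_meas HG HA x mr).
      apply: le_measure; rewrite ?inE//.
        apply: measurableU => //; apply: measurableC; exact: measurable_level (orbit_meas HG HA x mr).
      move=> g _; have [e|ne] := pselect (r (act (inv g) x) = r x); last by right.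
      by left; rewrite /N /= e.
    by rewrite Z0 (Ax : m (N x) = 0%E) adde0 leNgt mT.
  apply/eqP; rewrite -measure_le0 -Z0; apply: le_measure; rewrite ?inE//.
    apply: measurableC; exact: measurable_level (orbit_meas HG HA x mr).
  by move=> g /= gc e; move: gc; rewrite /N /= e leNgt cr.
have [A0|A1] := erg A mA Ainv.
  right; have nA : {ae mu, forall x, ~ A x}.
    by exists A; split => // x /contrapT.
  apply: filterS2 good nA => x [_ h] nAx; rewrite leNgt; apply/negP => /h.
  exact: nAx.
left; have nA : {ae mu, forall x, A x}.
  exists (~` A); split => //; first exact: measurableC.
  by rewrite probability_setC// A1 subee.
by apply: filterS2 good nA => x [h _] /h.
Qed.

End Ergodic.

(** * Mean ergodic theorem by L2 minimisation *)

Section MeanErgodic.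
Context {R : realType} {dG dX : measure_display}.
Context {G : measurableType dG} {X : measurableType dX}.
Variables (mul : G -> G -> G) (inv : G -> G) (one : G).
Variable m : {sigma_finite_measure set G -> \bar R}.
Variables (d : G -> G -> R) (C : R).
Variables (mu : probability X R) (act : G -> X -> X).
Hypothesis HG : doubling_group mul inv one m d C.
Hypothesis HA : pmp_action mul mu act.

Local Notation bvol := (ball_vol one m d).
Local Notation orbint := (orbit_int inv one m d act).
Local Notation avg := (orbit_avg inv one m d act).
Local Notation vanishing := (vanishing_avg inv one m d act).
Local Notation osc := (orbit_osc inv one m d act).
Local Notation I f := (\int[mu]_x f x)%R.
Implicit Types (s t a b e th : R) (f g r q : X -> R).

Lemma bounded_integrable f : bounded_meas f -> mu.-integrable setT (EFin \o f).
Proof.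
move=> [mf [M hM]]; apply: measurable_bounded_integrable => //.
  exact: le_lt_trans (probability_le1 mu measurableT) (ltry 1).
exists M; split; first by rewrite num_real.
by move=> y My x _ /=; rewrite (le_trans (hM _))// ltW.
Qed.

Lemma EFin_Rint f : bounded_meas f -> (I f)%:E = (\int[mu]_x (f x)%:E)%E.
Proof.
by move=> bf; rewrite fineK// (integrable_fin_num measurableT (bounded_integrable bf)).
Qed.

Lemma Rint_lin a b f g : bounded_meas f -> bounded_meas g ->
  I (fun x => a * f x + b * g x) = a * I f + b * I g.
Proof.
move=> bf bg; apply: EFin_inj.
rewrite EFin_Rint; last exact: bounded_meas_lin.
rewrite EFinD !EFinM !EFin_Rint//.
have If := bounded_integrable bf; have Ig := bounded_integrable bg.
under eq_integral do rewrite EFinD !EFinM.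
by rewrite integralD// ?integralZl//; exact: integrableZl.
Qed.

Lemma integral_probability_cst a : (\int[mu]_x a%:E = a%:E)%E.
Proof.
transitivity (a%:E * mu setT)%E; first exact: integral_cst.
by rewrite probability_setT mule1.
Qed.

Lemma Rint_cst a : I (cst a) = a.
Proof. by rewrite /Rintegral integral_probability_cst. Qed.

Lemma le_Rint f g : bounded_meas f -> bounded_meas g -> (forall x, f x <= g x) ->
  I f <= I g.
Proof.
move=> bf bg fg; rewrite -lee_fin !EFin_Rint//.
apply: le_integral => //; [exact: bounded_integrable|exact: bounded_integrable|].
by move=> x _; rewrite lee_fin.
Qed.

(** For nonnegative functions this is [integral_orbint]; adding a constant brings a bounded function
    to that case. *)
Lemma Rint_avg f s : 0 < s -> bounded_meas f -> I (avg f s) = I f.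
Proof.
move=> s0 bf; have vs := bvol_gt0 HG s0.
have pos h : bounded_meas h -> (forall y, 0 <= h y) -> I (avg h s) = I h.
  move=> bh h0; apply: (mulfI (lt0r_neq0 vs)); apply: EFin_inj.
  rewrite !EFinM !EFin_Rint//; last exact: (avg_bounded HG HA).
  rewrite -(integral_orbint HG HA (F := EFin \o h))//; last first.
    by apply/measurable_EFinP; case: bh.
  rewrite -ge0_integralZl_EFin//; last 3 first.
  - move=> x _; rewrite lee_fin divr_ge0 ?(ltW vs)// fine_ge0//.
    by apply: integral_ge0 => y _; rewrite lee_fin.
  - by apply/measurable_EFinP; apply: (avg_meas HG HA); case: bh.
  - exact: ltW.
  by apply: eq_integral => x _; rewrite -EFinM (avgE HG HA).
have [_ [M hM]] := bf; have b1 := bounded_meas_cst (X := X) (1 : R).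
have bA := avg_bounded HG HA s0 bf.
have := pos (fun y => 1 * f y + M * cst 1 y) (bounded_meas_lin _ _ bf b1).
rewrite (Rint_lin _ _ bf b1) (_ : avg _ s = (fun y => 1 * avg f s y + M * cst 1 y)).
  rewrite (Rint_lin _ _ bA b1) !mul1r => H; apply: (addIr (M * I (cst 1))).
  apply: H => y; rewrite /cst mulr1 mul1r.
  by have := hM y; rewrite ler_norml => /andP[+ _]; rewrite -subr_ge0 opprK addrC.
by apply/funext => y; rewrite (avg_lin HG HA)// (avg_cst act HG).
Qed.

Lemma Rint_sq_lin a b f g : bounded_meas f -> bounded_meas g ->
  I (fun x => (a * f x + b * g x) * (a * f x + b * g x)) =
  a ^+ 2 * I (fun x => f x * f x) + 2 * a * b * I (fun x => f x * g x)
  + b ^+ 2 * I (fun x => g x * g x).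
Proof.
move=> bf bg.
rewrite (_ : (fun _ => _) = (fun x => 1 * (a ^+ 2 * (f x * f x)
    + 2 * a * b * (f x * g x)) + b ^+ 2 * (g x * g x))); last first.
  by apply/funext => x; ring.
have [bff bfg bgg] := And3 (bounded_measM bf bf) (bounded_measM bf bg) (bounded_measM bg bg).
by rewrite (Rint_lin _ _ (bounded_meas_lin _ _ bff bfg) bgg) (Rint_lin _ _ bff bfg) mul1r.
Qed.

(** Applied with th = [avg f s x], which gives a variance, and with th = f x, which gives the
    quadratic oscillation along the orbit. *)
Lemma avg_sq f s x th : 0 < s -> bounded_meas f ->
  avg (fun y => (th - f y) * (th - f y)) s x =
  th ^+ 2 - 2 * th * avg f s x + avg (fun y => f y * f y) s x.
Proof.
move=> s0 bf; have b1 := bounded_meas_cst (X := X) (1 : R).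
rewrite (_ : (fun _ => _) = (fun y => 1 * (th ^+ 2 * cst 1 y
    + (- 2 * th) * f y) + 1 * (f y * f y))); last first.
  by apply/funext => y; rewrite /cst; ring.
rewrite (avg_lin HG HA) ?(avg_lin HG HA) ?(avg_cst act HG)//; first ring.
- exact: bounded_meas_lin.
- exact: bounded_measM.
Qed.

Lemma bounded_sq_sub f th : bounded_meas f ->
  bounded_meas (fun y => (th - f y) * (th - f y)).
Proof.
move=> bf; have bd : bounded_meas (fun y => th - f y).
  rewrite (_ : (fun _ => _) = (fun y => th * cst 1 y + (-1) * f y)).
    by apply: bounded_meas_lin => //; exact: bounded_meas_cst.
  by apply/funext => y; rewrite mulr1 mulN1r.
exact: bounded_measM.
Qed.

Lemma avg_ge0 f s x : 0 < s -> (forall y, 0 <= f y) -> 0 <= avg f s x.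
Proof.
move=> s0 f0; rewrite divr_ge0 ?(ltW (bvol_gt0 HG s0))// fine_ge0//.
by apply: integral_ge0 => y _; rewrite lee_fin.
Qed.

(** A variance is nonnegative, so (A_s f)^2 <= A_s (f^2) pointwise; then integrate with
    [Rint_avg]. *)
Lemma Rint_avg_sq_le f s : 0 < s -> bounded_meas f ->
  I (fun x => avg f s x * avg f s x) <= I (fun x => f x * f x).
Proof.
move=> s0 bf; have bff := bounded_measM bf bf; have bA := avg_bounded HG HA s0 bf.
rewrite -[leRHS](Rint_avg s0 bff); apply: le_Rint.
- exact: bounded_measM.
- exact: (avg_bounded HG HA).
move=> x; have := avg_sq x (avg f s x) s0 bf.
have : 0 <= avg (fun y => (avg f s x - f y) * (avg f s x - f y)) s x.
  by apply: avg_ge0 => // y; rewrite -expr2 sqr_ge0.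
move=> /[swap] ->; rewrite expr2 => h; lra.
Qed.

(** Stands in for the Cauchy-Schwarz inequality: with th of the size of an L2 norm it controls the
    L1 norm. It comes from (|y| - th)^2 >= 0. *)
Lemma norm_le_sq th (y : R) : 0 < th -> `|y| <= th + y * y / th.
Proof.
move=> th0; rewrite -(ler_pM2r th0) mulrDl divfK ?gt_eqF//.
have -> : y * y = `|y| * `|y| by rewrite -!expr2 real_normK ?num_real.
have := sqr_ge0 (`|y| - th); have n0 := normr_ge0 y; have := mulr_ge0 n0 (ltW th0).
by rewrite sqrrB !expr2 -mulr_natl; lra.
Qed.

Lemma integral_norm_le_sq th f : 0 < th -> bounded_meas f ->
  (\int[mu]_x (`|f x|)%:E <= (th + I (fun x => f x * f x) / th)%:E)%E.
Proof.
move=> th0 bf; have bff := bounded_measM bf bf.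
have b1 := bounded_meas_cst (X := X) (1 : R).
have bl := bounded_meas_lin th th^-1 b1 bff.
rewrite (_ : th + _ = I (fun x => th * cst 1 x + th^-1 * (f x * f x))); last first.
  by rewrite (Rint_lin _ _ b1 bff) Rint_cst mulr1 mulrC.
rewrite EFin_Rint//; apply: ge0_le_integral => //.
- by apply/measurable_EFinP; apply: measurableT_comp => //; case: bf.
- by apply/measurable_EFinP; case: bl.
- by move=> x _; rewrite lee_fin mulr1 mulrC -[_ * th^-1]mulrC mulrC norm_le_sq.
Qed.

(** [norm_le_sq] replaces |r x - r y| by its square. Expanding the square, averaging over the ball
    and integrating over X gives 2 I(r^2) - 2 I(r A_s r), as A_s preserves the mean. *)
Lemma integral_osc_le r s th : 0 < s -> 0 < th -> bounded_meas r ->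
  (\int[mu]_x osc r s x <= (bvol s * (th + (2 * I (fun x => r x * r x)
     - 2 * I (fun x => r x * avg r s x)) / th))%:E)%E.
Proof.
move=> s0 th0 br; have vs := bvol_gt0 HG s0.
have b1 := bounded_meas_cst (X := X) (1 : R).
have brr := bounded_measM br br; have bA := avg_bounded HG HA s0 br.
have brA := bounded_measM br bA; have bAr := avg_bounded HG HA s0 brr.
(* The ball average of th + (r x - r y)^2 / th, with the square expanded and arranged for
   [Rint_lin]. *)
pose w x := 1 * (1 * (th * cst 1 x + th^-1 * (r x * r x))
  + (- 2 / th) * (r x * avg r s x)) + th^-1 * avg (fun y => r y * r y) s x.
have bw1 := bounded_meas_lin th th^-1 b1 brr.
have bw2 := bounded_meas_lin 1 (- 2 / th) bw1 brA.
have bw : bounded_meas w := bounded_meas_lin 1 th^-1 bw2 bAr.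
have Iw : I w = th + (2 * I (fun x => r x * r x)
     - 2 * I (fun x => r x * avg r s x)) / th.
  rewrite (Rint_lin _ _ bw2 bAr) (Rint_lin _ _ bw1 brA) (Rint_lin _ _ b1 brr).
  by rewrite Rint_cst (Rint_avg s0 brr); field; rewrite gt_eqF.
rewrite -Iw EFinM EFin_Rint// -ge0_integralZl_EFin//; last 3 first.
- move=> x _; rewrite lee_fin.
  have -> : w x = th + avg (fun y => (r x - r y) * (r x - r y)) s x / th.
    by rewrite (avg_sq x (r x) s0 br) /w /cst; field; rewrite gt_eqF.
  rewrite addr_ge0 ?(ltW th0)// divr_ge0 ?(ltW th0)// avg_ge0// => y.
  by rewrite -expr2 sqr_ge0.
- by apply/measurable_EFinP; case: bw.
- exact: ltW.
apply: ge0_le_integral => //.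
- by move=> x _; apply: orbint_ge0 => y; rewrite lee_fin.
- by apply: (orbit_osc_meas HG HA); case: br.
- by apply: measurable_funeM; apply/measurable_EFinP; case: bw.
move=> x _; have bS := bounded_sq_sub (r x) br.
have bT := bounded_meas_lin th th^-1 b1 bS.
have -> : w x = avg (fun y => th * cst 1 y + th^-1 * ((r x - r y) * (r x - r y))) s x.
  rewrite (avg_lin HG HA)// (avg_cst act HG)// (avg_sq x (r x) s0 br) /w /cst.
  by field; rewrite gt_eqF.
rewrite -EFinM (avgE HG HA)//.
apply: (le_orbint HG HA (F2 := fun y => (th * cst 1 y + th^-1 * ((r x - r y) * (r x - r y)))%:E)).
- apply/measurable_EFinP; apply: measurableT_comp => //; apply: measurable_funB => //.
  by case: br.
- by move=> y; rewrite lee_fin.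
- by apply/measurable_EFinP; case: bT.
- by move=> y; rewrite lee_fin mulr1 [th^-1 * _]mulrC norm_le_sq.
Qed.

Lemma vanishing_lin a b f g : vanishing f -> vanishing g ->
  vanishing (fun x => a * f x + b * g x).
Proof.
move=> [bf hf] [bg hg]; split; first exact: bounded_meas_lin.
(* The summand 1 keeps the denominator positive when a = b = 0. *)
move=> e e0; have na0 : 0 < `|a| + `|b| + 1 by rewrite ltr_wpDl ?addr_ge0.
have e1 : 0 < e / (`|a| + `|b| + 1) by rewrite divr_gt0.
near=> t.
have t1 : forall x, `|avg f t x| <= e / (`|a| + `|b| + 1) by near: t; exact: hf.
have t2 : forall x, `|avg g t x| <= e / (`|a| + `|b| + 1) by near: t; exact: hg.
move=> x; rewrite (avg_lin HG HA)// (le_trans (ler_normD _ _))// normrM [X in _ + X]normrM.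
have h1 := ler_wpM2l (normr_ge0 a) (t1 x).
have h2 := ler_wpM2l (normr_ge0 b) (t2 x).
rewrite (le_trans (lerD h1 h2))// -mulrDl mulrCA ler_piMr ?(ltW e0)//.
by rewrite ler_pdivrMr// mul1r lerDl.
Unshelve. all: by end_near. Qed.

Lemma vanishing0 : vanishing (cst 0).
Proof.
split; first exact: bounded_meas_cst.
move=> e e0; near=> t => x; rewrite (avg_cst act HG) ?normr0 ?ltW//.
Unshelve. all: by end_near. Qed.

Lemma vanishing_Rint q : vanishing q -> I q = 0.
Proof.
move=> [bq hq]; apply/eqP; rewrite -normr_le0; apply/ler_addgt0Pl => e e0.
rewrite addr0; near (pinfty_nbhs R) => t.
have t0 : 0 < t by near: t; exact: nbhs_pinfty_gt.
have te : forall x, `|avg q t x| <= e by near: t; exact: hq.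
rewrite -(Rint_avg t0 bq); have bA := avg_bounded HG HA t0 bq.
have be c := bounded_meas_cst (X := X) (c : R).
rewrite ler_norml; apply/andP; split.
  rewrite -[leLHS]Rint_cst; apply: le_Rint => // x.
  by have := te x; rewrite ler_norml => /andP[].
rewrite -[leRHS]Rint_cst; apply: le_Rint => // x.
by have := te x; rewrite ler_norml => /andP[].
Unshelve. all: by end_near. Qed.

(** The number delta is the squared L2 distance from f to the vanishing class, an infimum and hence
    only approached. *)
Lemma near_minimizer f : bounded_meas f ->
  exists delta : R,
    (forall q, vanishing q -> delta <= I (fun x => (f x - q x) * (f x - q x))) /\
    (forall e, 0 < e -> exists q, vanishing q /\
       I (fun x => (f x - q x) * (f x - q x)) < delta + e).
Proof.
move=> bf.
pose A := [set y | exists q, vanishing q /\ y = I (fun x => (f x - q x) * (f x - q x))].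
have bA q : vanishing q -> bounded_meas (fun x => (f x - q x) * (f x - q x)).
  move=> [bq _]; have bd : bounded_meas (fun x => f x - q x).
    rewrite (_ : (fun _ => _) = (fun x => 1 * f x + (-1) * q x)); last first.
      by apply/funext => x; rewrite mul1r mulN1r.
    exact: bounded_meas_lin.
  exact: bounded_measM.
have hA : has_inf A.
  split; first by eexists; exists (cst 0); split; [exact: vanishing0|].
  exists 0 => _ [q [vq ->]]; rewrite -[leLHS](Rint_cst 0); apply: le_Rint.
  - exact: bounded_meas_cst.
  - exact: bA.
  - by move=> x; rewrite -expr2 sqr_ge0.
exists (inf A); split.
  by move=> q vq; apply: ge_inf; [case: hA|exists q].
move=> e e0; have [_ [q [vq ->]] h] := inf_adherent e0 hA.
by exists q.
Qed.

(** Tolerances 4^-n for squared L2 norms will become 2^-n for L1 norms. *)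
Lemma minimizing_sequence f : bounded_meas f ->
  exists r : nat -> X -> R, forall n, [/\ bounded_meas (r n),
    vanishing (fun x => f x - r n x),
    I (fun x => (r n x - r n.+1 x) * (r n x - r n.+1 x)) <= 4 * (4^-1 ^+ n) &
    forall s, 0 < s -> 2 * I (fun x => r n x * r n x)
      - 2 * I (fun x => r n x * avg (r n) s x) <= 4 * (4^-1 ^+ n)].
Proof.
move=> bf; have [delta [dle dnear]] := near_minimizer bf.
have eta0 n : 0 < (4^-1 : R) ^+ n by rewrite exprn_gt0.
have [q hq] := choice (fun n => dnear _ (eta0 n)).
pose r n x := f x - q n x.
have vq n : vanishing (q n) by case: (hq n).
have br n : bounded_meas (r n).
  rewrite (_ : r n = (fun x => 1 * f x + (-1) * q n x)); last first.
    by apply/funext => x; rewrite mul1r mulN1r.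
  by apply: bounded_meas_lin => //; case: (vq n).
have hr n : I (fun x => r n x * r n x) < delta + 4^-1 ^+ n by case: (hq n).
exists r => n; split => //.
- by rewrite (_ : (fun _ => _) = q n)//; apply/funext => x; rewrite /r subKr.
(* The midpoint of q_n and q_(n+1) is a competitor; the parallelogram law gives 2 * 4^-n + 2 *
   4^-(n+1), below 4 * 4^-n. *)
- have mid := dle _ (vanishing_lin 2^-1 2^-1 (vq n) (vq n.+1)).
  rewrite (_ : (fun _ => _) = (fun x => (2^-1 * r n x + 2^-1 * r n.+1 x)
     * (2^-1 * r n x + 2^-1 * r n.+1 x))) in mid; last first.
    by apply/funext => x; rewrite /r; field.
  rewrite (Rint_sq_lin _ _ (br n) (br n.+1)) in mid.
  rewrite (_ : (fun _ => _) = (fun x => (1 * r n x + (-1) * r n.+1 x)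
     * (1 * r n x + (-1) * r n.+1 x))); last by apply/funext => x; ring.
  rewrite (Rint_sq_lin _ _ (br n) (br n.+1)).
  have h1 := hr n; have h2 := hr n.+1; have h3 := eta0 n; rewrite exprS in h2.
  by move: mid h1 h2 h3; rewrite !expr2 => ? ? ? ?; lra.
(* The competitor q_n + (r_n - A_s r_n) / 2 leaves the remainder (r_n + A_s r_n) / 2, and the L2
   contraction bounds the square of A_s r_n. *)
- move=> s s0; have bA := avg_bounded HG HA s0 (br n).
  have vd := vanishing_coboundary HG HA s0 (br n).
  have bd : bounded_meas (fun x => r n x - avg (r n) s x) by case: vd.
  have := dle _ (vanishing_lin 1 2^-1 (vq n) vd).
  rewrite (_ : (fun _ => _) = (fun x => (2^-1 * r n x + 2^-1 * avg (r n) s x)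
     * (2^-1 * r n x + 2^-1 * avg (r n) s x))); last first.
    by apply/funext => x; rewrite /r; field.
  rewrite (Rint_sq_lin _ _ (br n) bA).
  have := Rint_avg_sq_le s0 (br n); have h1 := hr n; move: h1; rewrite !expr2 => ? ? ?; lra.
Qed.

Lemma mean_ergodic_approx f e : ergodic_action mu act -> bounded_meas f -> 0 < e ->
  exists q, vanishing q /\
    (\int[mu]_x (`|f x - I f - q x|)%:E <= e%:E)%E.
Proof.
move=> erg bf e0.
have [r hr] := minimizing_sequence bf.
have br n : bounded_meas (r n) by case: (hr n).
have mr n : measurable_fun setT (r n) by case: (br n).
have h0 n : 0 < (2^-1 : R) ^+ n by rewrite exprn_gt0.
have four n : (4^-1 : R) ^+ n = 2^-1 ^+ n * 2^-1 ^+ n.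
  by rewrite -exprMn -invfM -natrM.
(* With th = 2^-n the bound is 2^-n + 4 * 4^-n / 2^-n = 5 * 2^-n; the same computation serves for
   the oscillation. *)
have cau n : (\int[mu]_x (`|r n x - r n.+1 x|)%:E <= (5 * 2^-1 ^+ n)%:E)%E.
  have bd : bounded_meas (fun x => r n x - r n.+1 x).
    rewrite (_ : (fun _ => _) = (fun x => 1 * r n x + (-1) * r n.+1 x)); last first.
      by apply/funext => x; rewrite mul1r mulN1r.
    exact: bounded_meas_lin.
  apply: le_trans (integral_norm_le_sq (h0 n) bd) _; rewrite lee_fin.
  have [_ _ h _] := hr n; rewrite -lerBrDl ler_pdivrMr// (le_trans h)// four.
  by rewrite le_eqVlt; apply/orP; left; apply/eqP; ring.
have [v [mv hv]] := L1_complete mr cau.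
have oscr n s : 0 < s -> (\int[mu]_x osc (r n) s x <= (bvol s * (5 * 2^-1 ^+ n))%:E)%E.
  move=> s0; apply: le_trans (integral_osc_le s0 (h0 n) (br n)) _.
  rewrite lee_fin ler_pM2l ?(bvol_gt0 HG)//.
  have [_ _ _ /(_ s s0) h] := hr n; rewrite -lerBrDl ler_pdivrMr// (le_trans h)// four.
  by rewrite le_eqVlt; apply/orP; left; apply/eqP; ring.
have oscv s : 0 < s -> (\int[mu]_x osc v s x = 0)%E.
  move=> s0; have vs := bvol_gt0 HG s0.
  (* From |v x - v y| <= |r_n x - v x| + |r_n x - r_n y| + |r_n y - v y|: the outer terms contribute
     10 each and the middle one 5. *)
  have le_n n : (\int[mu]_x osc v s x <= (bvol s * (25 * 2^-1 ^+ n))%:E)%E.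
    pose F y := (`|r n y - v y|)%:E : \bar R.
    have mF : measurable_fun setT F.
      by apply/measurable_EFinP; apply: measurableT_comp => //; exact: measurable_funB.
    have F0 y : (0 <= F y)%E by rewrite lee_fin.
    apply: (@le_trans _ _ (\int[mu]_x ((bvol s)%:E * F x + osc (r n) s x + orbint F s x))%E).
      apply: ge0_le_integral => //.
      - by move=> x _; apply: orbint_ge0 => y; rewrite lee_fin.
      - exact: (orbit_osc_meas HG HA).
      - apply: emeasurable_funD; last exact: (orbint_meas HG HA).
        apply: emeasurable_funD; last exact: (orbit_osc_meas HG HA).
        exact: measurable_funeM.
      move=> x _.
      pose F1 : X -> \bar R := cst (F x).
      pose F2 y := (`|r n x - r n y|)%:E : \bar R.
      have mF1 : measurable_fun setT F1 by exact: measurable_cst.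
      have F10 y : (0 <= F1 y)%E by exact: F0.
      have mF2 : measurable_fun setT F2.
        by apply/measurable_EFinP; apply: measurableT_comp => //; exact: measurable_funB.
      have F20 y : (0 <= F2 y)%E by rewrite lee_fin.
      have mF12 : measurable_fun setT (fun y => F1 y + F2 y)%E by exact: emeasurable_funD.
      have F120 y : (0 <= F1 y + F2 y)%E by rewrite adde_ge0.
      have -> : ((bvol s)%:E * F x = orbint F1 s x)%E.
        by rewrite /orbit_int /F1 /cst (integral_ball_cst HG) mulrC.
      rewrite -[osc (r n) s x]/(orbint F2 s x) -(orbintD HG HA s x mF1 F10 mF2 F20).
      rewrite -(orbintD HG HA s x mF12 F120 mF F0).
      apply: (le_orbint HG HA).
      - by apply/measurable_EFinP; apply: measurableT_comp => //; exact: measurable_funB.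
      - by move=> y; rewrite lee_fin.
      - exact: emeasurable_funD.
      move=> y; rewrite /F1 /F2 /cst /F -!EFinD lee_fin.
      rewrite (_ : v x - v y = - (r n x - v x) + (r n x - r n y) + (r n y - v y)); last ring.
      by rewrite (le_trans (ler_normD _ _))// lerD2r (le_trans (ler_normD _ _))// normrN.
    rewrite ge0_integralD//; last 4 first.
    - move=> x _; rewrite adde_ge0//; first by rewrite mule_ge0// lee_fin ltW.
      by apply: orbint_ge0 => y; rewrite lee_fin.
    - apply: emeasurable_funD; last exact: (orbit_osc_meas HG HA).
      exact: measurable_funeM.
    - by move=> x _; apply: orbint_ge0.
    - exact: (orbint_meas HG HA).
    rewrite ge0_integralD//; last 4 first.
    - by move=> x _; rewrite mule_ge0// lee_fin ltW.
    - exact: measurable_funeM.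
    - by move=> x _; apply: orbint_ge0 => y; rewrite lee_fin.
    - exact: (orbit_osc_meas HG HA).
    rewrite ge0_integralZl_EFin ?(ltW vs)// (integral_orbint HG HA)//.
    have hF : ((bvol s)%:E * \int[mu]_x F x <= (bvol s * (2 * 5 * 2^-1 ^+ n))%:E)%E.
      rewrite [leRHS]EFinM; apply: lee_wpmul2l; last exact: hv.
      by rewrite lee_fin ltW.
    apply: le_trans (leeD (leeD hF (oscr n s s0)) hF) _.
    rewrite -!EFinD lee_fin -!mulrDr ler_pM2l//.
    by rewrite le_eqVlt; apply/orP; left; apply/eqP; ring.
  apply/eqP; rewrite eq_le integral_ge0 ?andbT; last first.
    by move=> x _; apply: orbint_ge0 => y; rewrite lee_fin.
  have cv : ((bvol s * (25 * 2^-1 ^+ n))%:E @[n --> \oo] --> (0 : R)%:E)%E.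
    apply: cvg_EFin; first exact: nearW.
    rewrite [X in _ --> X](_ : 0 = bvol s * (25 * 0)); last by rewrite !mulr0.
    apply: cvgMr; apply: cvgMr; apply: cvg_expr.
    by rewrite ger0_norm// invf_lt1// ltr1n.
  rewrite -[leRHS]/((0 : R)%:E) -(cvg_lim _ cv)//; apply: lime_ge; first by apply/cvg_ex; eexists; exact: cv.
  exact: nearW.
have [c hc] := osc0_cst HG HA erg mv oscv.
have rc n : (\int[mu]_x (`|r n x - c|)%:E <= (2 * 5 * 2^-1 ^+ n)%:E)%E.
  apply: le_trans (hv n); rewrite le_eqVlt; apply/orP; left; apply/eqP.
  apply: ge0_ae_eq_integral => //.
  - by apply/measurable_EFinP; apply: measurableT_comp => //; exact: measurable_funB.
  - by apply/measurable_EFinP; apply: measurableT_comp => //; exact: measurable_funB.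
  - by apply: filterS hc => x hx _; rewrite hx.
have b1 := bounded_meas_cst (X := X) (1 : R).
(* The function f - r_n is vanishing, hence of integral 0, which ties c to the mean of f. *)
have Irn n : I (r n) = I f.
  have [_ /vanishing_Rint + _ _] := hr n.
  rewrite (_ : (fun _ => _) = (fun x => 1 * f x + (-1) * r n x)); last first.
    by apply/funext => x; rewrite mul1r mulN1r.
  by rewrite (Rint_lin _ _ bf (br n)) mul1r mulN1r => /subr0_eq.
have cI n : `|I f - c| <= 2 * 5 * 2^-1 ^+ n.
  rewrite -lee_fin; apply: le_trans (rc n).
  have bd : bounded_meas (fun x => r n x - c).
    rewrite (_ : (fun _ => _) = (fun x => 1 * r n x + (- c) * cst 1 x)); last first.
      by apply/funext => x; rewrite mul1r mulr1.
    exact: bounded_meas_lin.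
  have -> : I f - c = I (fun x => r n x - c).
    rewrite -(Irn n) (_ : (fun x => _ - c) = (fun x => 1 * r n x + (- c) * cst 1 x)); last first.
      by apply/funext => x; rewrite mul1r mulr1.
    by rewrite (Rint_lin _ _ (br n) b1) Rint_cst mul1r mulr1.
  rewrite -abse_EFin EFin_Rint//.
  by apply: le_abse_integral => //; case/integrableP : (bounded_integrable bd).
(* The constant 20 is 10 from [rc] plus 10 from [cI]. *)
have [n hn] : exists n, 20 * 2^-1 ^+ n <= e.
  have cv : 20 * (2^-1 : R) ^+ n @[n --> \oo] --> 0.
    rewrite [X in _ --> X](_ : 0 = 20 * 0 :> R); last by rewrite mulr0.
    apply: cvgMr; apply: cvg_expr.
    by rewrite ger0_norm// invf_lt1// ltr1n.
  have [N _ hN] := cvgr0_norm_le _ cv _ e0; exists N.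
  by have := hN N (leqnn N); apply: le_trans; exact: ler_norm.
exists (fun x => f x - r n x); split; first by case: (hr n).
apply: (@le_trans _ _ (\int[mu]_x ((`|r n x - c|)%:E + (`|I f - c|)%:E))%E).
  apply: ge0_le_integral => //.
  - apply/measurable_EFinP; apply: measurableT_comp => //.
    apply: measurable_funB; last by apply: measurable_funB => //; case: bf.
    by apply: measurable_funB => //; case: bf.
  - apply: emeasurable_funD => //.
    by apply/measurable_EFinP; apply: measurableT_comp => //; exact: measurable_funB.
  move=> x _; rewrite -EFinD lee_fin.
  rewrite (_ : f x - I f - (f x - r n x) = (r n x - c) - (I f - c)); last ring.
  exact: ler_normB.
rewrite ge0_integralD//; last first.
  by apply/measurable_EFinP; apply: measurableT_comp => //; exact: measurable_funB.
rewrite integral_probability_cst.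
have := cI n; rewrite -lee_fin => h; apply: le_trans (leeD (rc n) h) _.
by rewrite -EFinD lee_fin (le_trans _ hn)// -mulrDl ler_pM2r//; lra.
Qed.

End MeanErgodic.

(** * Passage to Lp: pointwise and norm convergence *)

Lemma powR_add_le (R : realType) (p a b : R) : 0 <= p -> 0 <= a -> 0 <= b ->
  (a + b) `^ p <= 2 `^ p * (a `^ p + b `^ p).
Proof.
move=> p0; wlog ab : a b / a <= b => [hw a0 b0|a0 b0].
  have [ab|/ltW ba] := leP a b; first exact: hw.
  by rewrite addrC [X in _ * X]addrC hw.
apply: (@le_trans _ _ ((2 * b) `^ p)).
  apply: ge0_ler_powR => //; rewrite ?nnegrE ?addr_ge0 ?mulr_ge0//.
  by rewrite mulr_natl mulr2n lerD2r.
by rewrite powRM// ler_wpM2l ?powR_ge0// lerDr powR_ge0.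
Qed.

Section ErgodicTheorem.
Context {R : realType} {dG dX : measure_display}.
Context {G : measurableType dG} {X : measurableType dX}.
Variables (mul : G -> G -> G) (inv : G -> G) (one : G).
Variable m : {sigma_finite_measure set G -> \bar R}.
Variables (d : G -> G -> R) (C : R).
Variables (mu : probability X R) (act : G -> X -> X).
Hypothesis HG : doubling_group mul inv one m d C.
Hypothesis HA : pmp_action mul mu act.
Hypothesis erg : ergodic_action mu act.

Local Notation bvol := (ball_vol one m d).
Local Notation orbint := (orbit_int inv one m d act).
Local Notation avg := (orbit_avg inv one m d act).
Local Notation vanishing := (vanishing_avg inv one m d act).
Local Notation I f := (\int[mu]_x f x)%R.
Implicit Types (s t e p : R) (f g q : X -> R).

Lemma measurable_norm_sub f g : measurable_fun setT f -> measurable_fun setT g ->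
  measurable_fun setT (fun x => (`|f x - g x|)%:E : \bar R).
Proof.
move=> mf mg; apply/measurable_EFinP; apply: measurableT_comp => //.
exact: measurable_funB.
Qed.

Lemma measurable_powR_sub f g p : measurable_fun setT f -> measurable_fun setT g ->
  measurable_fun setT (fun x => (`|f x - g x| `^ p)%:E : \bar R).
Proof.
move=> mf mg; apply/measurable_EFinP; apply: (measurableT_comp (measurable_powR p)).
by apply: measurableT_comp => //; exact: measurable_funB.
Qed.

Lemma ge0_Zl d' (T : measurableType d') (nu : {measure set T -> \bar R})
    (D : set T) (a : R) (F : T -> \bar R) : measurable D -> 0 <= a ->
  measurable_fun setT F -> (forall x, 0 <= F x)%E ->
  (\int[nu]_(x in D) (a%:E * F x) = a%:E * \int[nu]_(x in D) F x)%E.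
Proof.
move=> mD a0 mF F0; apply: ge0_integralZl_EFin => //.
exact: measurable_funTS.
Qed.

Lemma integral_add_cst (a : R) (F : X -> \bar R) : 0 <= a ->
  measurable_fun setT F -> (forall x, 0 <= F x)%E ->
  (\int[mu]_x (F x + a%:E) = \int[mu]_x F x + a%:E)%E.
Proof.
by move=> a0 mF F0; rewrite ge0_integralD// integral_probability_cst.
Qed.

Lemma orbintZl (a : R) (F : X -> \bar R) t x : 0 <= a -> measurable_fun setT F ->
  (forall y, 0 <= F y)%E ->
  orbint (fun y => a%:E * F y)%E t x = (a%:E * orbint F t x)%E.
Proof.
move=> a0 mF F0; rewrite /orbit_int ge0_Zl//; first exact: (ball_meas HG).
exact: (orbit_meas HG HA).
Qed.

(** Cutting f at height n.+1 leaves a difference that is 0 or f, so dominated convergence handles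
    its p-th power. The height is at least 1, so the modulus of the difference is at most its p-th
    power, and one truncation serves both bounds. *)
Lemma truncation_approx f p e : 1 <= p -> measurable_fun setT f ->
  (\int[mu]_x (`|f x| `^ p)%:E < +oo)%E -> 0 < e ->
  exists g, [/\ bounded_meas g,
    (\int[mu]_x (`|f x - g x| `^ p)%:E <= e%:E)%E &
    (\int[mu]_x (`|f x - g x|)%:E <= e%:E)%E].
Proof.
move=> p1 mf fp e0; have p0 : 0 < p by rewrite (lt_le_trans _ p1).
pose g n x := f x * \1_[set y | `|f y| <= n.+1%:R] x.
have mnf : measurable_fun setT (fun x => `|f x|) by exact: measurableT_comp.
have memE n x : (x \in [set y | `|f y| <= n.+1%:R]) = (`|f x| <= n.+1%:R).
  by apply/idP/idP; rewrite inE.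
have bg n : bounded_meas (g n).
  split.
    apply: measurable_funM => //; apply/measurable_indicP.
    exact: measurable_sublevel mnf.
  exists n.+1%:R => x; rewrite /g indicE memE.
  case: (leP `|f x| n.+1%:R) => h; first by rewrite mulr1.
  by rewrite mulr0 normr0.
have gE n x : f x - g n x = if `|f x| <= n.+1%:R then 0 else f x.
  rewrite /g indicE memE.
  by case: (`|f x| <= n.+1%:R); rewrite ?mulr1 ?mulr0 ?subrr ?subr0.
have mpow n : measurable_fun setT (fun x => (`|f x - g n x| `^ p)%:E : \bar R).
  by apply: measurable_powR_sub => //; case: (bg n).
have mfp : measurable_fun setT (fun x => (`|f x| `^ p)%:E : \bar R).
  by apply/measurable_EFinP; exact: (measurableT_comp (measurable_powR p) mnf).
have cvf x : setT x -> (`|f x - g n x| `^ p)%:E @[n --> \oo] --> (0 : R)%:E.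
  move=> _; apply: cvg_near_cst; exists (Num.trunc `|f x|) => // n /= hn.
  rewrite gE ifT ?normr0 ?powR0 ?gt_eqF//.
  by rewrite (le_trans (ltW (truncnS_gt _)))// ler_nat ltnS.
have ifp : mu.-integrable setT (fun x => (`|f x| `^ p)%:E).
  apply/integrableP; split => //; under eq_integral do rewrite gee0_abs ?lee_fin ?powR_ge0//.
  exact: fp.
have dom x n : setT x -> (`|(`|f x - g n x| `^ p)%:E| <= (`|f x| `^ p)%:E)%E.
  move=> _; rewrite lee_fin ger0_norm ?powR_ge0// gE; case: ifPn => // _.
  by rewrite normr0 powR0 ?gt_eqF// powR_ge0.
have [_ _] := dominated_convergence measurableT mpow (measurable_cst _)
  (aeW mu cvf) ifp (aeW mu dom).
rewrite integral0 => /fine_cvgP[nfin cv].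
have [n [nf hn]] : exists n, (\int[mu]_x (`|f x - g n x| `^ p)%:E \is a fin_num)%E /\
    `|fine (\int[mu]_x (`|f x - g n x| `^ p)%:E)| <= e.
  have [N _ hN] := filterI nfin (cvgr0_norm_le _ cv _ e0).
  by exists N; exact: (hN N (leqnn N)).
have ge : (\int[mu]_x (`|f x - g n x| `^ p)%:E <= e%:E)%E.
  by rewrite -(fineK nf) lee_fin (le_trans (ler_norm _)).
exists (g n); split => //; apply: le_trans ge.
apply: ge0_le_integral => //.
- by apply: measurable_norm_sub => //; case: (bg n).
- move=> x _; rewrite lee_fin gE; case: ifPn => [_|]; first by rewrite normr0 powR_ge0.
  rewrite -ltNge => h; rewrite le1r_powR// (le_trans _ (ltW h))//.
  by rewrite ler1n.
Qed.

(** On a space of mass 1 the bound |f| <= 1 + |f|^p suffices. *)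
Lemma Lp_integrable f p : 1 <= p -> measurable_fun setT f ->
  (\int[mu]_x (`|f x| `^ p)%:E < +oo)%E -> (\int[mu]_x (`|f x|)%:E < +oo)%E.
Proof.
move=> p1 mf fp.
apply: (@le_lt_trans _ _ (\int[mu]_x (1%:E + (`|f x| `^ p)%:E))%E).
  apply: ge0_le_integral => //.
  - by apply/measurable_EFinP; exact: measurableT_comp.
  - apply: emeasurable_funD => //; apply/measurable_EFinP.
    by apply: (measurableT_comp (measurable_powR p)); exact: measurableT_comp.
  move=> x _; rewrite -EFinD lee_fin; have [h|/ltW h] := leP `|f x| 1.
    by rewrite (le_trans h)// lerDl powR_ge0.
  by rewrite (le_trans (le1r_powR h p1))// lerDr.
rewrite ge0_integralD//; last first.
  apply/measurable_EFinP; apply: (measurableT_comp (measurable_powR p)).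
  exact: measurableT_comp.
by rewrite integral_probability_cst lte_add_pinfty// ltry.
Qed.

Lemma integrable_norm_lty f : measurable_fun setT f ->
  (\int[mu]_x (`|f x|)%:E < +oo)%E -> mu.-integrable setT (EFin \o f).
Proof. by move=> mf fi; apply/integrableP; split; [exact/measurable_EFinP|]. Qed.

Lemma Rint_dist f g e : measurable_fun setT f ->
  (\int[mu]_x (`|f x|)%:E < +oo)%E -> bounded_meas g ->
  (\int[mu]_x (`|f x - g x|)%:E <= e%:E)%E -> `|I f - I g| <= e.
Proof.
move=> mf fi bg fg.
have If := integrable_norm_lty mf fi; have Ig := bounded_integrable mu bg.
have nf := integrable_fin_num measurableT If.
have ng := integrable_fin_num measurableT Ig.
rewrite -lee_fin; apply: le_trans fg.
rewrite /Rintegral -fineB// -integralB//.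
have Ifg := integrableB measurableT If Ig.
rewrite -fine_abse ?(integrable_fin_num _ Ifg)// fineK; last first.
  by rewrite abse_fin_num (integrable_fin_num _ Ifg).
by apply: le_abse_integral => //; case/integrableP : Ifg.
Qed.

(** Truncation, the bounded case and the difference of the two means cost e / 3 each. *)
Lemma mean_ergodic_L1 f e : measurable_fun setT f ->
  (\int[mu]_x (`|f x|)%:E < +oo)%E -> 0 < e ->
  exists q, vanishing q /\ (\int[mu]_x (`|f x - (I f + q x)|)%:E <= e%:E)%E.
Proof.
move=> mf fi e0; have e3 : 0 < e / 3 by rewrite divr_gt0.
have fi1 : (\int[mu]_x (`|f x| `^ 1)%:E < +oo)%E.
  by under eq_integral do rewrite powRr1//.
have [g [bg _ fg]] := truncation_approx (lexx 1) mf fi1 e3.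
have [q [vq gq]] := mean_ergodic_approx HG HA erg bg e3.
exists q; split => //.
have mg : measurable_fun setT g by case: bg.
have mq : measurable_fun setT q by case: vq => -[].
have D := Rint_dist mf fi bg fg.
apply: (@le_trans _ _ (\int[mu]_x ((`|f x - g x|)%:E + (`|g x - I g - q x|)%:E
    + (`|I f - I g|)%:E))%E).
  apply: ge0_le_integral => //.
  - by apply: measurable_norm_sub => //; exact: measurable_funD.
  - apply: emeasurable_funD => //; apply: emeasurable_funD; first exact: measurable_norm_sub.
    by apply: measurable_norm_sub => //; exact: measurable_funB.
  move=> x _; rewrite -!EFinD lee_fin.
  rewrite (_ : f x - (I f + q x) = (f x - g x) + (g x - I g - q x) - (I f - I g)); last ring.
  by rewrite (le_trans (ler_normB _ _))// lerD2r ler_normD.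
have m1 := measurable_norm_sub mf mg.
have m2 : measurable_fun setT (fun x => (`|g x - I g - q x|)%:E : \bar R).
  by apply: measurable_norm_sub => //; exact: measurable_funB.
rewrite ge0_integralD//; last 2 first.
- by move=> x _; rewrite adde_ge0// lee_fin.
- exact: emeasurable_funD.
rewrite ge0_integralD// integral_probability_cst.
apply: (@le_trans _ _ ((e / 3)%:E + (e / 3)%:E + (e / 3)%:E)%E).
  by apply: leeD; [exact: leeD|rewrite lee_fin].
by rewrite -!EFinD lee_fin; lra.
Qed.

Lemma avg_shift (c : R) q t x : 0 < t -> bounded_meas q ->
  avg (fun y => c + q y) t x = c + avg q t x.
Proof.
move=> t0 bq; rewrite (_ : (fun _ => _) = (fun y => c * cst 1 y + 1 * q y)); last first.
  by apply/funext => y; rewrite mulr1 mul1r.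
rewrite (avg_lin HG HA) ?(avg_cst act HG) ?mulr1 ?mul1r//; exact: bounded_meas_cst.
Qed.

Lemma bounded_shift (c : R) q : bounded_meas q -> bounded_meas (fun y => c + q y).
Proof.
move=> bq; rewrite (_ : (fun _ => _) = (fun y => c * cst 1 y + 1 * q y)).
  by apply: bounded_meas_lin => //; exact: bounded_meas_cst.
by apply/funext => y; rewrite mulr1 mul1r.
Qed.

Lemma pointwise_ergodic_L1 f : measurable_fun setT f ->
  (\int[mu]_x (`|f x|)%:E < +oo)%E ->
  {ae mu, forall x, avg f t x @[t --> +oo] --> I f}.
Proof.
move=> mf fi; have C1 := doubling_ge1 HG.
have h0 n : 0 < (2^-1 : R) ^+ n by rewrite exprn_gt0.
(* An L1 error of 4^-n against the level 2^-n in the maximal inequality leaves exceptional sets of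
   measure at most C^2 * 2^-n, a summable bound. *)
have [q hq] := choice (fun n => mean_ergodic_L1 mf fi (mulr_gt0 (h0 n) (h0 n))).
have vq n : vanishing (q n) by case: (hq n).
have bq n : bounded_meas (q n) by case: (vq n).
pose F n y := (`|f y - (I f + q n y)|)%:E : \bar R.
have mF n : measurable_fun setT (F n).
  by apply: measurable_norm_sub => //; case: (bounded_shift (I f) (bq n)).
have F0 n y : (0 <= F n y)%E by rewrite lee_fin.
have [E hE] := choice (fun n => ergodic_maximal_inequality HG HA (mF n) (F0 n) (h0 n)).
have mE n : measurable (E n) by case: (hE n).
have muE n : (mu (E n) <= (C ^+ 2 * 2^-1 ^+ n)%:E)%E.
  have [_ h _] := hE n; rewrite -(@lee_pmul2l _ (2^-1 ^+ n)%:E) ?lte_fin//.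
  apply: (le_trans h); apply: (@le_trans _ _ ((C ^+ 2)%:E * (2^-1 ^+ n * 2^-1 ^+ n)%:E)%E).
    apply: lee_wpmul2l; first by rewrite lee_fin exprn_ge0// (le_trans _ C1).
    by case: (hq n).
  by rewrite -!EFinM lee_fin mulrCA.
have sumE : (\sum_(n <oo) mu (E n) < +oo)%E.
  apply: (@le_lt_trans _ _ (C ^+ 2 * 2)%:E); last exact: ltry.
  apply: lime_le; first by apply: is_cvg_nneseries => n _ _; exact: measure_ge0.
  apply: nearW => N /=.
  suff : (\sum_(0 <= n < N) mu (E n) <= (C ^+ 2 * (2 * (1 - 2^-1 ^+ N)))%:E)%E.
    move/le_trans; apply; rewrite lee_fin ler_wpM2l ?exprn_ge0 ?(le_trans _ C1)//.
    by rewrite ler_piMr// gerBl exprn_ge0.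
  elim: N => [|N IH]; first by rewrite big_nil expr0 subrr !mulr0.
  rewrite big_nat_recr//=; apply: le_trans (leeD IH (muE N)) _.
  rewrite -EFinD lee_fin le_eqVlt; apply/orP; left; apply/eqP.
  by rewrite (exprS _ N); field.
(* By Borel-Cantelli almost every x lies in only finitely many [E n]. *)
exists (lim_sup_set E); split.
- by apply: bigcap_measurable => // n _; apply: bigcup_measurable.
- exact: lim_sup_set_cvg0.
move=> x /= nx; apply: contrapT => nE; apply: nx.
have {nE} [N hN] : exists N, forall n, (N <= n)%N -> ~ E n x.
  apply: contrapT => h; apply: nE => N _; apply: contrapT => h'.
  apply: h; exists N => n Nn En; apply: h'; exists n => //.
apply/cvgrPdist_le => e e0.
have cv : C * (2^-1 : R) ^+ n @[n --> \oo] --> 0.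
  rewrite [X in _ --> X](_ : 0 = C * 0 :> R); last by rewrite mulr0.
  by apply: cvgMr; apply: cvg_expr; rewrite ger0_norm// invf_lt1// ltr1n.
have e2 : 0 < e / 2 by rewrite divr_gt0.
have [N' _ hN'] := cvgr0_norm_le _ cv _ e2.
(* One n puts x outside [E n] and makes C * 2^-n at most e / 2; only then does t grow. *)
pose n := maxn N N'.
have hn : C * 2^-1 ^+ n <= e / 2.
  by apply: le_trans (ler_norm _) (hN' n _); rewrite /= leq_maxr.
have nEn : ~ E n x by apply: hN; rewrite leq_maxl.
have [_ hv] := vq n; have [_ _ /(_ x nEn) hmax] := hE n.
near=> t.
have t1 : 1 <= t by near: t; exact: nbhs_pinfty_ge.
have t0 : 0 < t by rewrite (lt_le_trans _ t1).
have qt : forall y, `|avg (q n) t y| <= e / 2 by near: t; exact: hv.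
have := le_trans (avg_dist HG HA x t0 mf (bounded_shift (I f) (bq n))) (hmax t t1).
rewrite avg_shift// lee_fin mulrC ler_pM2r ?(bvol_gt0 HG)// => h.
rewrite distrC (_ : avg f t x - I f = (avg f t x - (I f + avg (q n) t x)) + avg (q n) t x); last ring.
rewrite (le_trans (ler_normD _ _))//.
by have := qt x; lra.
Unshelve. all: by end_near. Qed.

(* Jensen's inequality for the ball average, from Young's inequality. *)
Lemma avg_dist_powR f g p t x : 1 <= p -> 0 < t -> measurable_fun setT f ->
  bounded_meas g ->
  ((bvol t * `|avg f t x - avg g t x| `^ p)%:E
   <= orbint (fun y => (`|f y - g y| `^ p)%:E) t x)%E.
Proof.
move=> p1 t0 mf bg; have mg : measurable_fun setT g by case: bg.
have := avg_dist HG HA x t0 mf bg.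
(* The conjugate exponent p / (p - 1) requires 1 < p. *)
move: p1; rewrite le_eqVlt => /predU1P[<-|p1] h.
  rewrite powRr1//; apply: (le_trans h); rewrite le_eqVlt; apply/orP; left; apply/eqP.
  by apply: eq_integral => u _; rewrite powRr1.
set a := `|_| in h *; have a0 : 0 <= a by exact: normr_ge0.
have p0 : 0 < p by rewrite (lt_trans _ p1).
have vt := bvol_gt0 HG t0.
have S0 : (0 <= orbint (fun y => (`|f y - g y| `^ p)%:E) t x)%E.
  by apply: orbint_ge0 => y; rewrite lee_fin powR_ge0.
case ES : (orbint _ t x) S0 => [S| |]// S0; last by rewrite leey.
pose q := p / (p - 1).
have p10 : 0 < p - 1 by rewrite subr_gt0.
have q0 : 0 < q by rewrite divr_gt0.
have pq : p^-1 + q^-1 = 1 by rewrite /q invf_div; field; rewrite gt_eqF.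
have aq : (a `^ (p - 1)) `^ q = a `^ p.
  by rewrite -powRrM; congr (_ `^ _); rewrite /q; field; rewrite gt_eqF.
(* The second factor is the constant a^(p-1), where a is the distance to be bounded; its q-th power
   is a^p. *)
have young y : `|f y - g y| * a `^ (p - 1) <= `|f y - g y| `^ p / p + a `^ p / q.
  by have := conjugate_powR (normr_ge0 (f y - g y)) (powR_ge0 a (p - 1)) p0 q0 pq; rewrite aq.
have mfp := measurable_powR_sub p mf mg.
have ap0 := powR_ge0 a p.
have K : ((a `^ (p - 1))%:E * orbint (fun y => (`|f y - g y|)%:E) t x
    <= (S / p + bvol t * (a `^ p / q))%:E)%E.
  rewrite -orbintZl ?powR_ge0//; last exact: measurable_norm_sub.
  apply: (@le_trans _ _ (orbint (fun y => (p^-1)%:E * (`|f y - g y| `^ p)%:E + (a `^ p / q)%:E)%E t x)).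
    apply: (le_orbint HG HA).
    - by apply: measurable_funeM; exact: measurable_norm_sub.
    - by move=> y; rewrite mule_ge0// lee_fin// powR_ge0.
    - by apply: emeasurable_funD => //; exact: measurable_funeM.
    - by move=> y; rewrite -!EFinM -EFinD lee_fin mulrC [p^-1 * _]mulrC.
  rewrite (orbintD HG HA)//; last 3 first.
  - exact: measurable_funeM.
  - by move=> y; rewrite mule_ge0// lee_fin ?powR_ge0// invr_ge0 ltW.
  - by move=> y; rewrite lee_fin divr_ge0// ltW.
  rewrite orbintZl ?invr_ge0 ?(ltW p0)// ES {1}/orbit_int (integral_ball_cst HG).
  by rewrite -EFinM -EFinD lee_fin [p^-1 * _]mulrC [_ * bvol t]mulrC.
have {K} : ((a `^ (p - 1))%:E * (bvol t * a)%:E <= (S / p + bvol t * (a `^ p / q))%:E)%E.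
  by apply: le_trans K; apply: lee_wpmul2l => //; rewrite lee_fin powR_ge0.
rewrite -EFinM !lee_fin mulrCA -[_ * a]mulrC mulr_powRB1//.
(* The term in a^p on the right is absorbed on the left, leaving the factor 1 / p on both sides. *)
have -> : q^-1 = 1 - p^-1 by rewrite -pq addrAC subrr add0r.
rewrite mulrBr mulr1 mulrBr addrCA lerDl subr_ge0 mulrA ler_pM2r ?invr_gt0//.
Qed.

(** Integrate [avg_dist_powR]; by [integral_orbint] both sides carry the factor [bvol t]. *)
Lemma integral_avg_dist f g p t : 1 <= p -> 0 < t -> measurable_fun setT f ->
  bounded_meas g ->
  (\int[mu]_x (`|avg f t x - avg g t x| `^ p)%:E
   <= \int[mu]_x (`|f x - g x| `^ p)%:E)%E.
Proof.
move=> p1 t0 mf bg; have mg : measurable_fun setT g by case: bg.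
have vt := bvol_gt0 HG t0.
pose A x := (`|avg f t x - avg g t x| `^ p)%:E : \bar R.
pose F x := (`|f x - g x| `^ p)%:E : \bar R.
have mA : measurable_fun setT A.
  exact: (measurable_powR_sub p (avg_meas HG HA t mf) (avg_meas HG HA t mg)).
have mF : measurable_fun setT F by exact: measurable_powR_sub.
have A0 x : (0 <= A x)%E by rewrite lee_fin powR_ge0.
have F0 x : (0 <= F x)%E by rewrite lee_fin powR_ge0.
have : (\int[mu]_x ((bvol t)%:E * A x) <= \int[mu]_x orbint F t x)%E.
  apply: ge0_le_integral; [exact: measurableT| | | |].
  - by move=> x _; rewrite mule_ge0// lee_fin ltW.
  - exact: measurable_funeM.
  - exact: (orbint_meas HG HA).
  - by move=> x _; rewrite -EFinM; exact: avg_dist_powR.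
rewrite (ge0_Zl mu measurableT (ltW vt) mA A0) (integral_orbint HG HA t mF F0).
by rewrite lee_pmul2l ?lte_fin.
Qed.

(** The averages and the mean lie in [-M, M], so the p-th power of their distance is at most (2
    M)^(p-1) times the distance, which reduces the claim to L1. *)
Lemma mean_ergodic_bounded g p e : 1 <= p -> bounded_meas g -> 0 < e ->
  \forall t \near +oo, (\int[mu]_x (`|avg g t x - I g| `^ p)%:E <= e%:E)%E.
Proof.
move=> p1 bg e0; have p0 : 0 < p by rewrite (lt_le_trans _ p1).
have [mg [M hM]] := bg.
have M0 : 0 <= M by rewrite (le_trans _ (hM point)).
(* The summand 1 makes K positive even when the power vanishes. *)
pose K := (2 * M) `^ (p - 1) + 1.
have K0 : 0 < K by rewrite ltr_wpDl ?powR_ge0.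
have e1 : 0 < e / (2 * K) by rewrite divr_gt0// mulr_gt0.
have gi : (\int[mu]_x (`|g x|)%:E < +oo)%E.
  by have /integrableP[] := bounded_integrable mu bg.
have [q [vq hq]] := mean_ergodic_L1 mg gi e1.
have bq : bounded_meas q by case: vq.
have bs := bounded_shift (I g) bq.
have Ig : `|I g| <= M.
  rewrite ler_norml; apply/andP; split.
    rewrite -[leLHS](Rint_cst mu); apply: le_Rint => //; first exact: bounded_meas_cst.
    by move=> x; have := hM x; rewrite ler_norml => /andP[].
  rewrite -[leRHS](Rint_cst mu); apply: le_Rint => //; first exact: bounded_meas_cst.
  by move=> x; have := hM x; rewrite ler_norml => /andP[].
near=> t.
have t0 : 0 < t by near: t; exact: nbhs_pinfty_gt.
have qt : forall x, `|avg q t x| <= e / (2 * K) by near: t; case: vq => _; apply.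
have mA := avg_meas HG HA t mg.
have mAs := avg_meas HG HA t (proj1 bs).
apply: (@le_trans _ _ (\int[mu]_x (K%:E * ((`|avg g t x - avg (fun y => I g + q y) t x| `^ 1)%:E
    + (e / (2 * K))%:E)))%E).
  apply: ge0_le_integral => //.
  - exact: measurable_powR_sub.
  - by apply: measurable_funeM; apply: emeasurable_funD => //; exact: measurable_powR_sub.
  move=> x _; rewrite powRr1// -EFinD -EFinM lee_fin avg_shift//.
  have le1 : `|avg g t x - I g| <= `|avg g t x - (I g + avg q t x)| + e / (2 * K).
    rewrite (_ : avg g t x - I g = (avg g t x - (I g + avg q t x)) + avg q t x); last ring.
    by rewrite (le_trans (ler_normD _ _))// lerD2l.
  apply: le_trans (ler_wpM2l (ltW K0) le1).
  rewrite -mulr_powRB1// mulrC ler_wpM2r//.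
  rewrite (@le_trans _ _ ((2 * M) `^ (p - 1)))//; last by rewrite lerDl.
  apply: ge0_ler_powR; rewrite ?nnegrE ?subr_ge0 ?mulr_ge0//.
  rewrite (le_trans (ler_normB _ _))// mulr_natl mulr2n lerD//.
  exact: (avg_bound HG HA).
have m1 := measurable_powR_sub 1 mA mAs.
rewrite ge0_Zl ?(ltW K0)//; last 2 first.
- by apply: emeasurable_funD => //; exact: measurable_cst.
- by move=> x; rewrite adde_ge0 ?lee_fin ?powR_ge0 ?(ltW e1).
rewrite (integral_add_cst (ltW e1) m1)//.
apply: (@le_trans _ _ (K%:E * ((e / (2 * K))%:E + (e / (2 * K))%:E))%E); last first.
  rewrite -EFinD -EFinM lee_fin le_eqVlt; apply/orP; left; apply/eqP.
  by field; rewrite gt_eqF.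
apply: lee_wpmul2l; first by rewrite lee_fin ltW.
apply: leeD => //; apply: le_trans (integral_avg_dist (lexx 1) t0 mg bs) _.
by under eq_integral do rewrite powRr1//.
Unshelve. all: by end_near. Qed.

Lemma mean_ergodic_Lp f p e : 1 <= p -> measurable_fun setT f ->
  (\int[mu]_x (`|f x| `^ p)%:E < +oo)%E -> 0 < e ->
  \forall t \near +oo, (\int[mu]_x (`|avg f t x - I f| `^ p)%:E <= e%:E)%E.
Proof.
move=> p1 mf fp e0; have p0 : 0 < p by rewrite (lt_le_trans _ p1).
pose K := (2 : R) `^ p; have K0 : 0 < K by exact: powR_gt0.
(* Two uses of [powR_add_le] give the three error terms the weights K, K^2 and K^2, and eta <= 1
   makes eta^p <= eta; the total is eta * (K + 2 K^2). *)
pose eta := Num.min 1 (e / (K + 2 * K * K)).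
have KK : 0 < K + 2 * K * K by rewrite addr_gt0// !mulr_gt0.
have eta0 : 0 < eta by rewrite lt_min ltr01 divr_gt0.
have eta1 : eta <= 1 by rewrite ge_min lexx.
have etae : eta * (K + 2 * K * K) <= e.
  by rewrite -ler_pdivlMr// ge_min lexx orbT.
have [g [bg fgp fg]] := truncation_approx p1 mf fp eta0.
have fi := Lp_integrable p1 mf fp.
have D := Rint_dist mf fi bg fg.
have mg : measurable_fun setT g by case: bg.
near=> t.
have t0 : 0 < t by near: t; exact: nbhs_pinfty_gt.
have gt : (\int[mu]_x (`|avg g t x - I g| `^ p)%:E <= eta%:E)%E.
  by near: t; exact: mean_ergodic_bounded.
have mAf := avg_meas HG HA t mf; have mAg := avg_meas HG HA t mg.
have m1 := measurable_powR_sub p mAf mAg.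
have m2 := measurable_powR_sub p mAg (@measurable_cst _ _ X _ setT (I g)).
have K20 : 0 <= K * K by rewrite mulr_ge0 ?ltW.
have mK1 := measurable_funeM K%:E m1; have mK2 := measurable_funeM (K * K)%:E m2.
have mS := emeasurable_funD mK1 mK2.
have p1x x : (0 <= K%:E * (`|avg f t x - avg g t x| `^ p)%:E)%E.
  by rewrite mule_ge0 ?lee_fin ?powR_ge0 ?(ltW K0).
have p2x x : (0 <= (K * K)%:E * (`|avg g t x - cst (I g) x| `^ p)%:E)%E.
  by rewrite mule_ge0 ?lee_fin ?powR_ge0.
pose c := K * K * eta.
have c0 : 0 <= c by rewrite !mulr_ge0 ?ltW.
apply: (@le_trans _ _ (\int[mu]_x (K%:E * (`|avg f t x - avg g t x| `^ p)%:E
   + (K * K)%:E * (`|avg g t x - I g| `^ p)%:E + c%:E))%E).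
  apply: ge0_le_integral; [exact: measurableT| |
      exact: (measurable_powR_sub p mAf (measurable_cst _))| |].
  - by move=> x _; rewrite lee_fin powR_ge0.
  - by apply: emeasurable_funD; [exact: mS|exact: measurable_cst].
  move=> x _; rewrite -!EFinM -!EFinD lee_fin.
  set A := avg f t x; set A' := avg g t x.
  apply: (@le_trans _ _ ((`|A - A'| + (`|A' - I g| + eta)) `^ p)).
    apply: ge0_ler_powR; rewrite ?nnegrE ?(ltW p0)// ?addr_ge0// ?(ltW eta0)//.
    rewrite (_ : A - I f = (A - A') + ((A' - I g) - (I f - I g))); last ring.
    rewrite (le_trans (ler_normD _ _))// lerD2l (le_trans (ler_normB _ _))// lerD2l//.
  have h1 := powR_add_le (ltW p0) (normr_ge0 (A - A')) (addr_ge0 (normr_ge0 (A' - I g)) (ltW eta0)).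
  have h2 := powR_add_le (ltW p0) (normr_ge0 (A' - I g)) (ltW eta0).
  have h3 : eta `^ p <= eta by rewrite ge1r_powR// eta0.
  apply: (le_trans h1); rewrite -/K mulrDr -addrA lerD2l /c -!mulrA -mulrDr.
  rewrite -mulrDr ler_pM2l//; apply: (le_trans h2).
  by rewrite -/K ler_pM2l// lerD2l.
rewrite (integral_add_cst c0 mS (fun x => adde_ge0 (p1x x) (p2x x))).
rewrite (ge0_integralD mu measurableT (fun x _ => p1x x) mK1 (fun x _ => p2x x) mK2).
rewrite !ge0_Zl ?(ltW K0)//.
apply: (@le_trans _ _ (K%:E * eta%:E + (K * K)%:E * eta%:E + c%:E)%E).
  apply: leeD => //; apply: leeD.
    apply: lee_wpmul2l; first by rewrite lee_fin ltW.
    exact: le_trans (integral_avg_dist p1 t0 mf bg) fgp.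
  by apply: lee_wpmul2l => //; rewrite lee_fin mulr_ge0 ?ltW.
rewrite -!EFinM -!EFinD lee_fin; apply: le_trans etae.
by rewrite le_eqVlt; apply/orP; left; apply/eqP; rewrite /c; ring.
Unshelve. all: by end_near. Qed.

Lemma Lnorm_EFinE f p : Lnorm mu p%:E (EFin \o f)
  = ((\int[mu]_x (`|f x| `^ p)%:E) `^ p^-1)%E.
Proof. by rewrite unlock; congr (_ `^ _)%E; apply: eq_integral. Qed.

Theorem ball_averages_ergodic f p : 1 <= p -> measurable_fun setT f ->
  (Lnorm mu p%:E (EFin \o f) < +oo)%E ->
  {ae mu, forall x, avg f t x @[t --> +oo] --> I f} /\
  (Lnorm mu p%:E (fun x => (avg f t x - I f)%:E) @[t --> +oo] --> 0%E).
Proof.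
move=> p1 mf fL; have p0 : 0 < p by rewrite (lt_le_trans _ p1).
have fp : (\int[mu]_x (`|f x| `^ p)%:E < +oo)%E.
  have -> : (\int[mu]_x (`|f x| `^ p)%:E = \int[mu]_x (`|(EFin \o f) x| `^ p))%E.
    by apply: eq_integral.
  by rewrite -poweR_Lnorm ?gt_eqF// poweR_lty.
split; first exact: pointwise_ergodic_L1 mf (Lp_integrable p1 mf fp).
(* The p-th root of the estimate of [mean_ergodic_Lp] at e^p. *)
have small e : 0 < e ->
    \forall t \near +oo, (Lnorm mu p%:E (fun x => (avg f t x - I f)%:E) <= e%:E)%E.
  move=> e0; have ep : 0 < e `^ p by exact: powR_gt0.
  have := mean_ergodic_Lp p1 mf fp ep; apply: filterS => t ht.
  rewrite (Lnorm_EFinE (fun x => avg f t x - I f)).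
  have -> : e%:E = ((e `^ p)%:E `^ p^-1)%E.
    by rewrite poweR_EFin -powRrM divff ?gt_eqF// powRr1// ltW.
  apply: gt0_ler_poweR => //; rewrite ?in_itv/= ?leey ?andbT ?invr_ge0 ?(ltW p0)//.
  - by apply: integral_ge0 => x _; rewrite lee_fin powR_ge0.
  - by rewrite lee_fin powR_ge0.
apply/fine_cvgP; split.
  have := small 1 ltr01; apply: filterS => t ht.
  by rewrite ge0_fin_numE ?Lnorm_ge0// (le_lt_trans ht)// ltry.
apply/cvgrPdist_le => e e0; have := small e e0; apply: filterS => t ht /=.
rewrite sub0r normrN ger0_norm ?fine_ge0 ?Lnorm_ge0//.
by rewrite -lee_fin fineK// ge0_fin_numE ?Lnorm_ge0// (le_lt_trans ht)// ltry.
Qed.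

End ErgodicTheorem.

(** * Borel sets and continuous maps *)

Section Borel.
Variable G : ptopologicalType.

Lemma borel_open (U : set G) : open U -> measurable (U : set (Borel G)).
Proof. exact: sub_sigma_algebra. Qed.

Lemma borel_closed (U : set G) : closed U -> measurable (U : set (Borel G)).
Proof.
move=> cU; rewrite -[U]setCK; apply: (@measurableC _ (Borel G)).
by apply: borel_open; exact: closed_openC.
Qed.

Lemma borel_continuous (f : G -> G) : continuous f ->
  measurable_fun setT (f : Borel G -> Borel G).
Proof.
move=> cf.
apply: (@measurability _ _ (Borel G) (Borel G) setT f (@open G)) => // _ [U oU <-].
by rewrite setTI; apply: borel_open; move/continuousP : cf; apply.
Qed.

(* Second countability makes every open subset of G * G a countable union of
   rectangles, so that the Borel sets of G * G are product measurable. *)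
Lemma borel_continuous2 (f : G * G -> G) : @second_countable G -> continuous f ->
  measurable_fun setT (f : Borel G * Borel G -> Borel G).
Proof.
move=> [D cD [Dopen Dbasis]] cf.
apply: (@measurability _ _ (Borel G * Borel G)%type (Borel G) setT f (@open G)) => // _ [U oU <-].
rewrite setTI; have oW : open (f @^-1` U) by move/continuousP : cf; apply.
pose I := [set P : set G * set G | [/\ D P.1, D P.2 & P.1 `*` P.2 `<=` f @^-1` U]].
have -> : f @^-1` U = \bigcup_(P in I) (P.1 `*` P.2).
  apply/seteqP; split => [[x y] Wxy|z [P [_ _ PW] /PW]//].
  have [[V1 V2] /= [nx ny] sub] : nbhs (x, y) (f @^-1` U) by exact: open_nbhs_nbhs.
  have [P1 [DP1 P1x] s1] := Dbasis x V1 nx.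
  have [P2 [DP2 P2y] s2] := Dbasis y V2 ny.
  exists (P1, P2) => //; split => //= -[a b] [/= aP bP].
  by apply: sub; split; [exact: s1|exact: s2].
have cI : countable I.
  apply: (@sub_countable _ _ I (D `*` D)); last exact: countableX.
  by apply: subset_card_le => P [].
rewrite bigcup_set_type; apply: countable_bigcupT_measurable.
  by rewrite (eq_countable (card_setT _)).
move=> [P /= /[!inE] -[P1 P2 _]].
by apply: measurableX; apply: borel_open; exact: Dopen.
Qed.

End Borel.

(** * From the topological group to the measurable setting *)

Section SigmaFiniteCopy.
Context d (T : measurableType d) (R : realType).
Variable mu : {measure set T -> \bar R}.

(** A copy of [mu] indexed by the proof of sigma-finiteness, so that the structure can be attached
    to a measure for which it is only a hypothesis. *)
Definition sigma_finite_copy of sigma_finite setT mu : set T -> \bar R := mu.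

Variable sf : sigma_finite setT mu.

HB.instance Definition _ := Measure.on (sigma_finite_copy sf).

HB.instance Definition _ :=
  Measure_isSigmaFinite.Build _ _ _ (sigma_finite_copy sf) sf.

End SigmaFiniteCopy.

Lemma lcsc_doubling_group (R : realType) (G : ptopologicalType)
    (mul : G -> G -> G) (inv : G -> G) (one : G)
    (mG : {measure set (Borel G) -> \bar R}) (d : G -> G -> R) (C : R)
    (m : {sigma_finite_measure set (Borel G) -> \bar R}) :
  (forall A, m A = mG A) ->
  lcsc_group mul inv one ->
  left_haar_measure mul mG ->
  left_invariant_metric mul d ->
  (forall t : R, 0 < t ->
     compact (cball d one t) /\ (0 < mG (cball d one t))%E) ->
  (forall t : R, 0 < t ->
     (mG (cball d one (2 * t)) <= C%:E * mG (cball d one t))%E) ->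
  (forall g : G,
     fine (mG (symdiff (rtrans mul (cball d one t) g) (cball d one t)))
       / fine (mG (cball d one t)) @[t --> +oo] --> 0) ->
  doubling_group (G := Borel G) mul inv one m d C.
Proof.
move=> mE [mulA mul1 mulV [cmul cinv] [hG _ scG]] [haar fcpt _] [d0 dC dtri dmul].
move=> ballP dbl fol.
have dxx x : d x x = 0 by exact/d0.
have closed_cball (t : R) : 0 < t -> closed (cball d one t).
  by move=> /ballP[+ _]; exact: compact_closed.
have ball_meas t : measurable (cball d one t : set (Borel G)).
  (* Compactness is assumed for positive radii; for the others the ball is contained in the
     singleton of [one]. *)
  have [t0|t0] := ltP 0 t; first by apply: borel_closed; exact: closed_cball.
  have : cball d one t `<=` [set one].
    move=> g gt; apply/esym/d0/eqP; rewrite eq_le (le_trans gt)//=.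
    by have := dtri one g one; rewrite dxx (dC g) => ?; lra.
  move=> /subset_set1[->|->]; first exact: (@measurable0 _ (Borel G)).
  apply: borel_closed; apply: accessible_closed_set1.
  exact: hausdorff_accessible.
have cmulr u : continuous (mul^~ u).
  move=> x; apply: (@continuous_comp _ _ _ (fun y => (y, u)) (fun q : G * G => mul q.1 q.2)).
    by apply: cvg_pair => /=; [exact: cvg_id|exact: cvg_cst].
  exact: cmul.
(* Compact translates are Borel and of finite measure, as the comparison with the symmetric
   difference requires. *)
have crt (t : R) u : 0 < t -> compact (rtrans mul (cball d one t) u).
  move=> /ballP[ct _]; apply: continuous_compact => //.
  exact/continuous_subspaceT/cmulr.
have mulm : measurable_fun setT (fun q : Borel G * Borel G => mul q.1 q.2 : Borel G).
  exact: (borel_continuous2 (f := fun q => mul q.1 q.2)).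
have balloo t : (mG (cball d one t) < +oo)%E.
  have t1 : 0 < `|t| + 1 by rewrite ltr_wpDl.
  have [ct _] := ballP _ t1; apply: le_lt_trans (fcpt _ ct).
  apply: le_measure; rewrite ?inE; [exact: ball_meas|exact: ball_meas|].
  by move=> g /= /le_trans; apply; rewrite (le_trans (ler_norm t))// lerDl.
split=> //.
- by move=> x; case: (mul1 x).
- by move=> x; case: (mul1 x).
- by move=> x; case: (mulV x).
- by move=> x; case: (mulV x).
- exact: borel_continuous.
(* The preimage under left multiplication by g is the image under left multiplication by g^-1. *)
- move=> g A mA; rewrite !mE -(haar (inv g) A mA); congr (mG _).
  apply/seteqP; split => [x /= Ax|_ [a Aa <-]] /=.
    by exists (mul g x) => //; rewrite mulA (mulV g).1 (mul1 x).1.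
  by rewrite mulA (mulV g).2 (mul1 a).1.
- by move=> t t0; rewrite mE; case: (ballP t t0).
- by move=> t; rewrite mE.
- by move=> t t0; rewrite !mE; exact: dbl.
move=> u.
(* Asymptotic invariance is used at u^-1: the points of B_t that u moves out are those outside B_t
   u^-1, one half of the symmetric difference. *)
apply: (squeeze_cvgr _ (cvg_cst 0) (fol (inv u))).
near=> t.
have t0 : 0 < t by near: t; exact: nbhs_pinfty_gt.
have sub : cball d one t `\` [set g | cball d one t (mul g u)] `<=`
    symdiff (rtrans mul (cball d one t) (inv u)) (cball d one t).
  move=> g [gB ngB]; right; split => // -[b bB bg]; apply: ngB.
  by rewrite /= -bg -mulA (mulV u).1 (mul1 b).2.
have mrt : measurable (rtrans mul (cball d one t) (inv u) : set (Borel G)).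
  by apply: borel_closed; apply: compact_closed => //; exact: (crt t (inv u) t0).
have mB := ball_meas t.
have msd : measurable (symdiff (rtrans mul (cball d one t) (inv u)) (cball d one t) : set (Borel G)).
  by apply: (@measurableU _ (Borel G)); exact: (@measurableD _ (Borel G)).
have mdiff : measurable (cball d one t `\` [set g | cball d one t (mul g u)] : set (Borel G)).
  apply: (@measurableD _ (Borel G)) => //.
  have := borel_continuous (cmulr u); rewrite /measurable_fun.
  by move=> /(_ measurableT _ mB); rewrite setTI.
have sdoo : (mG (symdiff (rtrans mul (cball d one t) (inv u)) (cball d one t)) < +oo)%E.
  apply: (@le_lt_trans _ _ (mG (rtrans mul (cball d one t) (inv u)) + mG (cball d one t))%E).
    apply: le_trans (measureU2 mG _ _) _; try exact: (@measurableD _ (Borel G)).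
    by apply: leeD; apply: le_measure; rewrite ?inE//; exact: (@measurableD _ (Borel G)).
  rewrite lte_add_pinfty//; apply: fcpt; exact: (crt t (inv u) t0).
have v0 : 0 <= (fine (mG (cball d one t)))^-1 by rewrite invr_ge0 fine_ge0.
rewrite !mE; apply/andP; split; first by rewrite mulr_ge0// fine_ge0.
rewrite ler_wpM2r// fine_le ?ge0_fin_numE ?measure_ge0//.
- by apply: le_lt_trans sdoo; apply: le_measure; rewrite ?inE.
- by apply: le_measure; rewrite ?inE.
Unshelve. all: by end_near. Qed.

Theorem theorem5p1 (R : realType) (G : ptopologicalType)
    (mul : G -> G -> G) (inv : G -> G) (one : G)
    (mG : {measure set (Borel G) -> \bar R}) (d : G -> G -> R) (C : R) :
  lcsc_group mul inv one ->
  left_haar_measure mul mG ->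
  left_invariant_metric mul d ->
  (forall t : R, 0 < t ->
     compact (cball d one t) /\ (0 < mG (cball d one t))%E) ->
  (forall t : R, 0 < t ->
     (mG (cball d one (2 * t)) <= C%:E * mG (cball d one t))%E) ->
  (forall g : G,
     fine (mG (symdiff (rtrans mul (cball d one t) g) (cball d one t)))
       / fine (mG (cball d one t)) @[t --> +oo] --> 0) ->
  forall p : R, 1 <= p ->
  forall (dX : measure_display) (X : measurableType dX)
         (mX : probability X R) (act : G -> X -> X),
  standard_borel R X ->
  mp_action mul one mX act ->
  ergodic_action mX act ->
  forall f : X -> R,
  measurable_fun [set: X] f ->
  (Lnorm mX p%:E (EFin \o f) < +oo)%E ->
  {ae mX, forall x, ball_average inv one d mG act f t x @[t --> +oo%R]
                      --> (fine (\int[mX]_y (f y)%:E) : R^o)} /\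
  (Lnorm mX p%:E (fun x => (ball_average inv one d mG act f t x
                              - fine (\int[mX]_y (f y)%:E))%:E)
     @[t --> +oo] --> 0%E).
Proof.
move=> lcsc haar dist ballP dbl fol p p1 dX X mX act _ mpa erg f mf fL.
have [hG fcpt] : hausdorff_space G /\ forall K : set G, compact K -> (mG K < +oo)%E.
  by case: lcsc => _ _ _ _ []; case: haar.
(* Balls of integer radius exhaust the group and are compact, hence of finite measure; n.+1 keeps
   the radius positive. *)
have sf : sigma_finite setT mG.
  exists (fun n => cball d one n.+1%:R : set (Borel G)).
    apply/esym/seteqP; split => // g _.
    by exists (Num.trunc (d one g)) => //=; rewrite /cball /= ltW// truncnS_gt.
  move=> n; have [cB _] := ballP n.+1%:R (ltr0Sn _ _); split; last exact: fcpt.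
  by apply: borel_closed; exact: compact_closed.
pose m : {sigma_finite_measure set (Borel G) -> \bar R} := sigma_finite_copy sf.
have HG : doubling_group (G := Borel G) mul inv one m d C.
  exact: lcsc_doubling_group.
have HA : pmp_action (G := Borel G) mul mX act by case: mpa.
(* [orbit_avg] and [ball_average] agree by conversion, as do [m] and [mG]. *)
exact: (ball_averages_ergodic HG HA erg p1 mf fL).
Qed.
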